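(* Let $\nu:F^*\to\mathbb{C}^*$ be a character of conductor $P^r$ with $r\geq1$, and let $\Pi=\Pi(\nu,1)$ be the corresponding principal series representation of $GL_2(F)$. Let $K/F$ be the unramified quadratic extension. Let $\chi$ denote a character of $K^*$ such that $\chi$ agrees with $\nu$ on $F^*$ and such that $\chi$ has level $s>r$. Let $u_s$ denote a nonzero vector on the unique line in $u_{P^s}(\nu)$ that is a $\nu$-eigenspace for $B(s)$. Then $u_s$ is a test vector for $\chi$. If $s\leq r$, where $s$ is the level of $\chi$, then the new vector $v_r$ is a test vector for $\chi$.
   Context: $F$ is a finite extension of $\mathbb{Q}_p$ with ring of integers $\mathcal{O}$, maximal ideal $P=(\varpi)$. $G(\mathcal{O})=GL_2(\mathcal{O})$; $B(s)\subset G(\mathcal{O})$ is the subgroup of matrices with lower left entry in $P^s$. $K^*$ is embedded in $GL_2(F)$ so that $\mathcal{O}_K^*\subset G(\mathcal{O})$. The level (conductor) of a character $\chi$ of $K^*$ is the smallest positive integer $s$ such that $\chi$ is trivial on $\{u\in\mathcal{O}_K^*:u\equiv1\bmod P^s\mathcal{O}_K\}$. For $s\ge r$ regard $\nu$ as a character of $B(s)$ via $\begin{pmatrix}a&b\\c&d\end{pmatrix}\mapsto\nu(a)$. Put $u_{P^r}(\nu)=\mathrm{Ind}_{B(r)}^{G(\mathcal{O})}(\nu)$ and, for $s>r$, let $u_{P^s}(\nu)$ be the complement of $\sum_{r\le t<s}\mathrm{Ind}_{B(t)}^{G(\mathcal{O})}(\nu)$ in $\mathrm{Ind}_{B(s)}^{G(\mathcal{O})}(\nu)$.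 These representations are irreducible, each contains a unique line on which $B(s)$ acts by $\nu$, and $\Pi|_{G(\mathcal{O})}=\bigoplus_{s\ge r}u_{P^s}(\nu)$, so $u_{P^s}(\nu)$ is regarded as a subspace of $\Pi$. The new vector $v_r\in\Pi$ is a nonzero vector (unique up to scalar) on which $B(r)$ acts by $\nu$. A vector $v\in\Pi$ is a test vector for $\chi$ if $\ell_\chi(v)\neq0$, where $\ell_\chi$ is a nonzero element of the one-dimensional space $\mathrm{Hom}_{K^*}(\Pi,\chi)$. *)

(* Defs.v *)
From HB Require Import structures.
From mathcomp Require Import all_boot all_order all_algebra all_field.
From mathcomp Require Import boolp classical_sets reals.
From mathcomp Require Import complex.
Set Implicit Arguments.
Unset Strict Implicit.
Unset Printing Implicit Defensive.
Import Order.TTheory GRing.Theory Num.Theory.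
Local Open Scope ring_scope.
Local Open Scope classical_set_scope.

(** * Discretely valued fields *)

(* A valuation is a map [F -> int] whose value at 0 is irrelevant: every use
   below treats 0 separately. *)
Record normalized_valuation (F : fieldType) (v : F -> int) : Prop := {
  valuationM : forall x y, x != 0 -> y != 0 -> v (x * y) = v x + v y;
  valuationD : forall x y, x != 0 -> y != 0 -> x + y != 0 ->
    Num.min (v x) (v y) <= v (x + y);
  valuation_surj : exists2 x, x != 0 & v x = 1
}.

(* P^n; in particular P^0 is the ring of integers. *)
Definition powP (F : fieldType) (v : F -> int) (n : nat) : {pred F} :=
  [pred x | (x == 0) || (n%:Z <= v x)].

Definition ringO (F : fieldType) (v : F -> int) : {pred F} := powP v 0.

Definition unitO (F : fieldType) (v : F -> int) : {pred F} :=
  [pred x | (x != 0) && (v x == 0)].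

(* Cardinality of O/P (0 if O/P is infinite), through complete systems of
   representatives. *)
Definition residue_card (F : fieldType) (v : F -> int) : nat :=
  xget 0%N [set q : nat | exists t : 'I_q -> F,
    (forall i, t i \in ringO v) /\
    (forall x, x \in ringO v -> exists! i, x - t i \in powP v 1)].

(* (Qp, vp) is the completion of the rationals for the p-adic valuation. *)
Record is_Qp (p : nat) (Qp : fieldType) (vp : Qp -> int) : Prop := {
  Qp_prime : prime p;
  Qp_val : normalized_valuation vp;
  Qp_nat : forall n : nat, (0 < n)%N ->
    (n%:R : Qp) != 0 /\ vp n%:R = (logn p n)%:Z;
  Qp_dense : forall (x : Qp) (n : nat),
    exists q : rat, x - ratr q \in powP vp n;
  Qp_complete : forall u : nat -> Qp,
    (forall n : nat, exists N : nat, forall i j : nat,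
       (N <= i)%N -> (N <= j)%N -> u i - u j \in powP vp n) ->
    exists x : Qp, forall n : nat, exists N : nat, forall i : nat,
      (N <= i)%N -> u i - x \in powP vp n
}.

Definition extends_val (F : fieldType) (L : fieldExtType F) (e : nat)
    (v : F -> int) (w : L -> int) : Prop :=
  forall x : F, x != 0 -> w x%:A = v x *+ e.

(* L/Qp is a finite extension by its type; its normalized valuation w extends
   vp up to the (positive) ramification index. *)
Definition padic_field (Qp : fieldType) (vp : Qp -> int)
    (L : fieldExtType Qp) (w : L -> int) : Prop :=
  normalized_valuation w /\ exists2 e : nat, (0 < e)%N & extends_val e vp w.

(* Ramification index 1; the residue extension is separable since the residue
   fields are finite. *)
Definition unramified_quadratic (F : fieldType) (v : F -> int)
    (K : fieldExtType F) (vK : K -> int) : Prop :=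
  [/\ normalized_valuation vK, extends_val 1 v vK & \dim {:K} = 2%N].

(** * Characters of F^* and K^* *)

(* A character of L^* is given by a map on L whose value at 0 is irrelevant;
   its values on L^* are then automatically nonzero. *)
Definition mul_char (L : fieldType) (C : fieldType) (mu : L -> C) : Prop :=
  mu 1 = 1 /\ (forall x y, x != 0 -> y != 0 -> mu (x * y) = mu x * mu y).

(* The conductor is P^r, where r is least such that nu is trivial on the
   r-th unit group (O^* for r = 0 and 1 + P^r for r > 0). *)
Definition conductor (F C : fieldType) (v : F -> int) (nu : F -> C)
    (r : nat) : Prop :=
  let trivial_on n :=
    forall x, x \in unitO v -> x - 1 \in powP v n -> nu x = 1 in
  trivial_on r /\ (forall n, trivial_on n -> (r <= n)%N).

Definition level (F : fieldType) (C : fieldType) (v : F -> int)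
    (K : fieldExtType F) (vK : K -> int) (chi : K -> C) (s : nat) : Prop :=
  let trivial_on n :=
    forall (u : K) (a : F) (y : K), u \in unitO vK ->
      a \in powP v n -> y \in ringO vK -> u = 1 + a *: y -> chi u = 1 in
  [/\ (0 < s)%N, trivial_on s
    & forall n, (0 < n)%N -> trivial_on n -> (s <= n)%N].

(** * Subgroups of GL_2 *)

Definition GL2O (F : fieldType) (v : F -> int) : {pred 'M[F]_2} :=
  [pred k : 'M[F]_2 | [forall i, forall j, k i j \in ringO v]
                      && (\det k \in unitO v)].

Definition Bgrp (F : fieldType) (v : F -> int) (s : nat) : {pred 'M[F]_2} :=
  [pred k : 'M[F]_2 | (k \in GL2O v) && (k 1 0 \in powP v s)].

Definition principal_congruence (F : fieldType) (v : F -> int) (n : nat) :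
    {pred 'M[F]_2} :=
  [pred k : 'M[F]_2 | (k \in GL2O v)
     && [forall i, forall j, k i j - (i == j)%:R \in powP v n]].

(** * Representations *)

(* A function on GL_2(F), or on G(O) = GL_2(O), is represented by its
   extension by zero to all 2 x 2 matrices. All the group actions are by right
   translation. *)
Definition rho (F C : fieldType) (g : 'M[F]_2) (f : 'M[F]_2 -> C) :
    'M[F]_2 -> C :=
  fun x => f (x *m g).

Definition nonzero_fun (T : Type) (C : fieldType) (f : T -> C) : Prop :=
  exists x, f x != 0.

(* u is an eigenvector on which B(s) acts by the character nu. *)
Definition nu_eigenvector (F C : fieldType) (v : F -> int) (nu : F -> C)
    (s : nat) (u : 'M[F]_2 -> C) : Prop :=
  nonzero_fun u /\
  (forall k x, k \in Bgrp v s -> rho k u x = nu (k 0 0) * u x).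

(* |a|^(1/2) for the normalized absolute value |a| = q^(- v a), q = #(O/P). *)
Definition sqrt_abs (R : realType) (F : fieldType) (v : F -> int) (a : F) :
    R[i] :=
  (sqrtC (residue_card v)%:R) ^ (- v a).

(* Pi(nu, 1): the space of the normalized induction to GL_2(F) of the
   character (a b; 0 d) |-> nu a of the Borel subgroup. *)
Definition principal_series (R : realType) (F : fieldType) (v : F -> int)
    (nu : F -> R[i]) : set ('M[F]_2 -> R[i]) :=
  [set f | [/\ forall x, x \notin unitmx -> f x = 0,
      forall b x : 'M[F]_2, b \in unitmx -> b 1 0 = 0 -> x \in unitmx ->
        f (b *m x) = nu (b 0 0) * sqrt_abs R v (b 0 0 / b 1 1) * f x
    & exists n : nat, forall k x : 'M[F]_2,
        k \in principal_congruence v n -> f (x *m k) = f x]].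

(* Ind_{B(s)}^{G(O)} nu. As B(s) contains B(s.+1), these spaces increase with
   s. Smoothness is automatic for s >= r, P^r being the conductor of nu. *)
Definition IndB (F C : fieldType) (v : F -> int) (nu : F -> C) (s : nat) :
    set ('M[F]_2 -> C) :=
  [set f | (forall x, x \notin GL2O v -> f x = 0) /\
    (forall b x : 'M[F]_2, b \in Bgrp v s -> x \in GL2O v ->
       f (b *m x) = nu (b 0 0) * f x)].

Definition sumIndB (F C : fieldType) (v : F -> int) (nu : F -> C)
    (r s : nat) : set ('M[F]_2 -> C) :=
  [set f | exists g : nat -> ('M[F]_2 -> C),
    (forall t, (r <= t < s)%N -> IndB v nu t (g t)) /\
    (forall x, f x = \sum_(r <= t < s) g t x)].

Definition linear_subspace (T : Type) (C : fieldType) (W : set (T -> C)) :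
    Prop :=
  W (fun=> 0) /\
  (forall a f g, W f -> W g -> W (fun x => a * f x + g x)).

(* W is (the space of) u_{P^s}(nu): a G(O)-stable complement of the sum of the
   Ind_{B(t)} nu, r <= t < s, in Ind_{B(s)} nu. For s = r the sum is zero and
   W is the whole of Ind_{B(r)} nu. *)
Definition uP (F C : fieldType) (v : F -> int) (nu : F -> C) (r s : nat)
    (W : set ('M[F]_2 -> C)) : Prop :=
  [/\ linear_subspace W, W `<=` IndB v nu s,
      forall k f, k \in GL2O v -> W f -> W (rho k f),
      forall f, IndB v nu s f -> exists g h,
        [/\ sumIndB v nu r s g, W h & forall x, f x = g x + h x]
    & forall f, W f -> sumIndB v nu r s f -> forall x, f x = 0].

(* By the Iwasawa decomposition, restriction to G(O) is injective on Pi(nu, 1);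
   it identifies Pi(nu, 1) with a space of functions on G(O) that contains
   each Ind_{B(s)} nu, s >= r. *)
Definition restrO (F C : fieldType) (v : F -> int) (f : 'M[F]_2 -> C) :
    'M[F]_2 -> C :=
  fun x => if x \in GL2O v then f x else 0.

Definition uP_in_Pi (R : realType) (F : fieldType) (v : F -> int)
    (nu : F -> R[i]) (W : set ('M[F]_2 -> R[i])) : set ('M[F]_2 -> R[i]) :=
  [set f | principal_series v nu f /\ W (restrO v f)].

(** * Test vectors *)

(* Hom_{K^*}(V, chi), where K^* acts through iota; only the restriction of l to
   V is relevant. *)
Definition HomK (F C : fieldType) (K : fieldExtType F)
    (iota : K -> 'M[F]_2) (chi : K -> C) (V : set ('M[F]_2 -> C)) :
    set (('M[F]_2 -> C) -> C) :=
  [set l | (forall a f g, V f -> V g ->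
              l (fun x => a * f x + g x) = a * l f + l g) /\
           (forall k f, k != 0 -> V f ->
              l (rho (iota k) f) = chi k * l f)].

(* l is a nonzero element of Hom_{K^*}(V, chi), which is one-dimensional. *)
Definition HomK_generator (F C : fieldType) (K : fieldExtType F)
    (iota : K -> 'M[F]_2) (chi : K -> C) (V : set ('M[F]_2 -> C))
    (l : ('M[F]_2 -> C) -> C) : Prop :=
  [/\ HomK iota chi V l, exists2 f, V f & l f != 0
    & forall l', HomK iota chi V l' ->
        exists c, forall f, V f -> l' f = c * l f].

Definition test_vector (F C : fieldType) (K : fieldExtType F)
    (iota : K -> 'M[F]_2) (chi : K -> C) (V : set ('M[F]_2 -> C))
    (u : 'M[F]_2 -> C) : Prop :=
  V u /\ (exists2 l, HomK_generator iota chi V l & l u != 0).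

(* Main.v *)
Require Import Defs.
From mathcomp Require Import all_boot all_order all_algebra all_field.
From mathcomp Require Import boolp classical_sets reals complex.
From mathcomp Require Import ring.
Set Implicit Arguments.
Unset Strict Implicit.
Unset Printing Implicit Defensive.
Import Order.TTheory GRing.Theory Num.Theory.
Local Open Scope ring_scope.

(** Write [G = GL_2(F)], let [B] be its upper triangular subgroup, and regard
    [K^*] as a subgroup of [G] through [iota].

    The invariant functional. As [K] is a field, [K^*] acts transitively on the
    projective line, so that [G = B K^*] with [B] and [K^*] meeting in [F^*]
    ([iota_iwasawa]). A function in [Pi] is thus determined by its restriction to
    [K^*], and since [K] is unramified ([K^* = F^* O_K^*]) the functional is
    [period f], the integral of [chi^-1 * f] over [O_K^*]. The integral is an
    average over the finitely many classes modulo [1 + P^n O_K] for [n] large;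
    finiteness of the residue field is proved from the density of the rationals
    in [Qp] and the finiteness of the degree. If [u] has a nonzero period, then
    the [chi]-isotypic projection of every [f] is a multiple of that of [u], with
    ratio the quotient of the periods, so every functional in [Hom_{K^*}(Pi, chi)]
    is a multiple of [period] ([period_generator]). It remains to show that the
    periods of the vectors in question do not vanish.

    Shape of the vectors. Because the conductor of [nu] is [P^r], a function in
    [Pi] on which [B(m)] acts by [nu], [m >= r], vanishes on the matrices of
    [GL_2(O)] outside [B(r)] ([eigenvector_support]), and on [B(r)] it has the
    form [nu(a) psi(c)], where [(a, c)] is the first column and [psi(c)] depends
    only on the smaller of [m] and the valuation of [c] ([eigenvector_section],
    [eigenvector_radial]).

    Periods. If [u] is a unit of [K] with [iota u] in [B(m)], then [u] is congruent
    modulo [P^m O_K] to the upper left entry [a] of [iota u] ([iota_lower_left]);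
    if in addition [chi] is trivial on [1 + P^m O_K], then [chi u = nu a]. Hence the
    function [nu(a)] on [B(m)], extended by zero, has as its period the volume of
    a nonempty open set ([period_indicator_neq0]). When [s <= r] this applies to
    the new vector, with [m = r].

    When [s = t + 1 > r], write [u_s] as [G + kappa E], where [E] is that
    function for [m = s] and [psi] is constant on [P^t] in [G] ([radial_split]).
    The function [G] is fixed by [1 + P^t O_K], where [chi] is not trivial, so its
    period is zero ([period_section_eq0]). If [kappa] were zero, [u_s] would lie
    in [Ind_{B(t)} nu], which meets the complement [u_{P^s}(nu)] only in zero. *)

(** * Discrete valuations *)

Section Valuation.
Variables (F : fieldType) (v : F -> int) (Hv : normalized_valuation v).
Implicit Types (x y e d : F) (m n : nat).

Lemma valuation1 : v 1 = 0.
Proof.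
have := valuationM Hv (oner_neq0 F) (oner_neq0 F).
by rewrite mulr1 => /eqP; rewrite -subr_eq0 opprD addrA subrr sub0r oppr_eq0 => /eqP.
Qed.

Lemma valuationN x : v (- x) = v x.
Proof.
have [->|x0] := eqVneq x 0; first by rewrite oppr0.
have n1 : (-1 : F) != 0 by rewrite oppr_eq0 oner_neq0.
have e : v (-1) = 0.
  have := valuationM Hv n1 n1; rewrite mulrNN mulr1 valuation1 => /esym/eqP.
  by rewrite -mulr2n mulrn_eq0 => /eqP.
by rewrite -mulN1r (valuationM Hv) // e add0r.
Qed.

Lemma valuationV x : x != 0 -> v x^-1 = - v x.
Proof.
move=> x0; apply/eqP; rewrite -addr_eq0 -(valuationM Hv) ?invr_eq0 //.
by rewrite mulVf // valuation1.
Qed.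

Lemma valuationX x n : x != 0 -> v (x ^+ n) = v x *+ n.
Proof.
move=> x0; elim: n => [|n IH]; first by rewrite expr0 valuation1 mulr0n.
by rewrite exprS (valuationM Hv) ?expf_neq0 // IH mulrS.
Qed.

Lemma powP_nz n x : x != 0 -> (x \in powP v n) = (n%:Z <= v x).
Proof. by rewrite inE => /negbTE ->. Qed.

Lemma powP_0 n : 0 \in powP v n.
Proof. by rewrite inE eqxx. Qed.

Lemma powPD n x y : x \in powP v n -> y \in powP v n -> x + y \in powP v n.
Proof.
have [->|x0] := eqVneq x 0; first by rewrite add0r.
have [->|y0] := eqVneq y 0; first by rewrite addr0.
have [->|xy0] := eqVneq (x + y) 0; first by rewrite powP_0.
rewrite !powP_nz // => hx hy.
apply: le_trans (valuationD Hv x0 y0 xy0).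
by rewrite le_min hx hy.
Qed.

Lemma powPN n x : (- x \in powP v n) = (x \in powP v n).
Proof. by rewrite !inE oppr_eq0 valuationN. Qed.

Lemma powPB n x y : x \in powP v n -> y \in powP v n -> x - y \in powP v n.
Proof. by move=> hx hy; apply: powPD => //; rewrite powPN. Qed.

Lemma powPM m n x y :
  x \in powP v m -> y \in powP v n -> x * y \in powP v (m + n).
Proof.
have [->|x0] := eqVneq x 0; first by rewrite mul0r (powP_0 (m + n)).
have [->|y0] := eqVneq y 0; first by rewrite mulr0 (powP_0 (m + n)).
rewrite !powP_nz ?mulf_neq0 // (valuationM Hv) // PoszD => hx hy; exact: lerD.
Qed.

Lemma powPMl n x y : x \in ringO v -> y \in powP v n -> x * y \in powP v n.
Proof. exact: (@powPM 0 n). Qed.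

Lemma powPMr n x y : x \in powP v n -> y \in ringO v -> x * y \in powP v n.
Proof. by move=> hx hy; rewrite mulrC powPMl. Qed.

Lemma powPW m n x : (m <= n)%N -> x \in powP v n -> x \in powP v m.
Proof.
move=> mn; rewrite !inE => /orP[->//|h]; apply/orP; right.
by apply: le_trans h; rewrite lez_nat.
Qed.

Lemma powPO n x : x \in powP v n -> x \in ringO v.
Proof. exact: powPW. Qed.

Lemma unitO_nz x : x \in unitO v -> x != 0.
Proof. by case/andP. Qed.

Lemma unitO_val x : x \in unitO v -> v x = 0.
Proof. by case/andP=> _ /eqP. Qed.

Lemma unitO_O x : x \in unitO v -> x \in ringO v.
Proof. by move=> hx; rewrite powP_nz ?unitO_nz // unitO_val. Qed.

Lemma unitO1 : 1 \in unitO v.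
Proof. by rewrite inE oner_neq0 valuation1 eqxx. Qed.

Lemma unitOM x y : x \in unitO v -> y \in unitO v -> x * y \in unitO v.
Proof.
move=> hx hy; rewrite inE mulf_neq0 ?unitO_nz //=.
by rewrite (valuationM Hv) ?unitO_nz // !unitO_val.
Qed.

Lemma unitOV x : x \in unitO v -> x^-1 \in unitO v.
Proof.
move=> hx; rewrite inE invr_eq0 unitO_nz //=.
by rewrite valuationV ?unitO_nz // unitO_val // oppr0.
Qed.

Lemma unitO_div x y : x \in unitO v -> y \in unitO v -> x / y \in unitO v.
Proof. by move=> hx hy; apply: unitOM => //; apply: unitOV. Qed.

Lemma powP_unitM e n x : e \in unitO v -> (e * x \in powP v n) = (x \in powP v n).
Proof.
move=> he; apply/idP/idP=> h; last exact: powPMl (unitO_O he) h.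
by rewrite -(mulKf (unitO_nz he) x); apply: powPMl h; apply/unitO_O/unitOV.
Qed.

Lemma unitO_powP n e : e \in unitO v -> (e \in powP v n) = (n == 0%N).
Proof. by move=> he; rewrite powP_nz ?unitO_nz // unitO_val // lez_nat leqn0. Qed.

Lemma unitO_factor x y :
  x \in ringO v -> y \in ringO v -> x * y \in unitO v -> x \in unitO v.
Proof.
move=> hx hy /andP[]; rewrite mulf_eq0 negb_or => /andP[x0 y0].
rewrite (valuationM Hv) // => /eqP e; move: hx hy; rewrite !powP_nz // => hx hy.
rewrite inE x0 /= eq_le hx andbT -e lerDl; exact: hy.
Qed.

Lemma unitO_notin_powP x : x \in ringO v -> (x \in unitO v) = (x \notin powP v 1).
Proof.
have [-> _|x0] := eqVneq x 0; first by rewrite (powP_0 1) [LHS]inE eqxx.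
rewrite [x \in ringO v]powP_nz // => h; rewrite powP_nz // [LHS]inE x0 /=.
by rewrite eq_le h andbT -ltNge (_ : 1%N%:Z = 0 + 1) // ltzD1.
Qed.

Lemma unitOD n e d :
  (0 < n)%N -> e \in unitO v -> d \in powP v n -> e + d \in unitO v.
Proof.
move=> n0 he /(powPW n0) hd; rewrite unitO_notin_powP; last first.
  by apply: powPD; [exact: unitO_O|exact: powPO hd].
apply/negP=> h; have : e \in powP v 1 by rewrite -(addrK d e) powPB.
by rewrite unitO_powP.
Qed.

Lemma div_powP x y n :
  x \in powP v n -> y \notin powP v n.+1 -> x / y \in ringO v.
Proof.
move=> hx hy; have y0 : y != 0 by apply: contra hy => /eqP ->; exact: powP_0.
have [->|x0] := eqVneq x 0; first by rewrite mul0r (powP_0 0).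
move: hx hy; rewrite !powP_nz ?mulf_neq0 ?invr_eq0 // (valuationM Hv) ?invr_eq0 //.
rewrite valuationV // subr_ge0 -ltNge -addn1 PoszD ltzD1 => h1 h2; exact: le_trans h2 h1.
Qed.

Lemma uniformizer_exists : exists2 w : F, w != 0 & v w = 1.
Proof. exact: valuation_surj. Qed.

End Valuation.

(** * Finiteness of the residue rings *)

(** Finiteness of [O/P^n], through representatives that may repeat a class. *)
Definition finite_mod (F : fieldType) (v : F -> int) (n : nat) : Prop :=
  exists T : seq F, forall x, x \in ringO v -> exists2 t, t \in T & x - t \in powP v n.

Lemma finite_mod_all (F : fieldType) (v : F -> int) (Hv : normalized_valuation v) :
  finite_mod v 1 -> forall n, finite_mod v n.
Proof.
move=> [T HT]; elim=> [|n [S HS]].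
  by exists [:: 0] => x hx; exists 0; rewrite ?mem_head // subr0.
have [w w0 vw] := uniformizer_exists Hv.
exists [seq t + w * z | t <- T, z <- S] => x hx.
have [t tT xt] := HT x hx.
have hy : (x - t) / w \in ringO v.
  apply: (div_powP Hv xt); rewrite powP_nz // vw; exact/negP.
have [z zS yz] := HS _ hy.
exists (t + w * z); first by apply: allpairs_f.
have -> : x - (t + w * z) = w * ((x - t) / w - z).
  by rewrite mulrBr mulrCA divff // mulr1 opprD addrA.
by apply: (powPM Hv (m := 1)) => //; rewrite powP_nz // vw.
Qed.

Section ResidueOfExtension.
Variables (E : fieldType) (v : E -> int) (L : fieldExtType E) (w : L -> int).
Variable e : nat.
Hypotheses (Hv : normalized_valuation v) (Hw : normalized_valuation w).
Hypotheses (e_gt0 : (0 < e)%N) (Hext : extends_val e v w).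

Lemma ext_powP n a : a \in powP v n -> a%:A \in powP w n.
Proof.
have [->|a0] := eqVneq a 0; first by rewrite scale0r !(powP_0 _ n).
rewrite !powP_nz ?scaler_eq0 ?negb_or ?a0 ?oner_neq0 // Hext // => h.
apply: le_trans (h) _; case: e e_gt0 => // k _; rewrite mulrS lerDl.
by apply/mulrn_wge0/(le_trans _ h).
Qed.

(** Linear independence, over the residue field of [E], of the residue classes
    of the members of [xs]. *)
Definition residually_free (xs : seq L) : Prop :=
  forall c : nat -> E, (forall i, c i \in ringO v) ->
    \sum_(i < size xs) c i *: xs`_i \in powP w 1 ->
    forall i, (i < size xs)%N -> c i \in powP v 1.

(** A linear relation over [E] can be scaled so that its coefficients are
    integral and one of them is 1, and then it gives a relation between the
    residue classes. Hence the residue degree is at most the degree. *)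
Lemma residually_free_free xs : residually_free xs -> free xs.
Proof.
move=> Hxs; rewrite -[xs]/(val (in_tuple xs)); apply/freeP => k Hk i1.
apply/eqP/negPn/negP => k1.
case: (@arg_minP _ _ _ i1 (fun i => k i != 0) (fun i => v (k i)) k1) => i0 ki0 Hmin.
pose c (n : nat) := if insub n is Some i then k i / k i0 else 0.
have cE (i : 'I_(size xs)) : c i = k i / k i0 by rewrite /c valK.
have : c i0 \in powP v 1.
  apply: Hxs => //.
    move=> n; rewrite /c; case: insubP => [i _ _|_]; last exact: powP_0.
    have [->|ki] := eqVneq (k i) 0; first by rewrite mul0r (powP_0 v 0).
    rewrite powP_nz ?mulf_neq0 ?invr_eq0 // (valuationM Hv) ?invr_eq0 //.
    by rewrite (valuationV Hv) // subr_ge0 Hmin.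
  rewrite (_ : \sum_(i < _) _ = (k i0)^-1 *: (\sum_(i < size xs) k i *: xs`_i)).
    by rewrite Hk scaler0 powP_0.
  by rewrite scaler_sumr; apply: eq_bigr => i _; rewrite cE scalerA mulrC.
by rewrite cE divff // (unitO_powP _ (unitO1 Hv)).
Qed.

(** The combinations of the members of [xs] with coefficients in [O_E] fall into
    finitely many residue classes, because the coefficients do. *)
Lemma span_finite (T : seq E) :
    (forall x, x \in ringO v -> exists2 t, t \in T & x - t \in powP v 1) ->
  forall xs, {subset xs <= ringO w} -> exists S : seq L,
    forall c : nat -> E, (forall i, c i \in ringO v) ->
      exists2 z, z \in S & \sum_(i < size xs) c i *: xs`_i - z \in powP w 1.
Proof.
move=> HT; elim=> [|x xs IH] Hxs.
  by exists [:: 0] => c _; exists 0; rewrite ?mem_head // big_ord0 subr0 powP_0.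
have [y ysub|S HS] := IH; first by apply: Hxs; rewrite inE ysub orbT.
exists [seq t *: x + z | t <- T, z <- S] => c Hc.
have [t tT ct] := HT _ (Hc 0%N).
have [z zS Hz] := HS (fun i => c i.+1) (fun i => Hc i.+1).
exists (t *: x + z); first by apply: allpairs_f.
rewrite big_ord_recl /= opprD addrACA -scalerBl; apply: (powPD Hw) => //.
rewrite -[_ *: x]mulr_algl (powPMr Hw (ext_powP ct)) // Hxs //.
by rewrite mem_head.
Qed.

(** The members of [O_L] reduce to combinations of a maximal residually free
    family with coefficients in the finite residue field of [E]. *)
Lemma finite_residue_ext : finite_mod v 1 -> finite_mod w 1.
Proof.
move=> [T HT].
pose P m := `[< exists xs : seq L,
  [/\ size xs = m, {subset xs <= ringO w} & residually_free xs] >].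
have exP : exists m, P m by exists 0%N; apply/asboolP; exists [::]; split.
have ubP m : P m -> (m <= \dim {:L})%N.
  move=> /asboolP[xs [<- _ /residually_free_free]]; rewrite /free => /eqP <-.
  exact/dimvS/subvf.
case: (ex_maxnP exP ubP) => m /asboolP[xs [xsm xsO xsfree]] maxm.
have [S HS] := span_finite HT xsO.
exists S => y hy.
have : ~ residually_free (y :: xs).
  move=> yfree; have : P m.+1.
    apply/asboolP; exists (y :: xs); split=> //=; first by rewrite xsm.
    by move=> z; rewrite inE => /orP[/eqP->//|/xsO].
  by move=> /maxm; rewrite ltnn.
rewrite /residually_free => /existsNP[c] /not_implyP[cO] /not_implyP[].
rewrite big_ord_recl /= => Hsum /existsNP[j] /not_implyP[jlt cj].
have c0 : c 0%N \notin powP v 1.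
  apply/negP => c0; apply: cj.
  have Hxs : \sum_(i < size xs) c i.+1 *: xs`_i \in powP w 1.
    rewrite -(addKr (c 0%N *: y) (\sum_(i < _) _)) addrC; apply: (powPB Hw) => //.
    by rewrite -[_ *: y]mulr_algl (powPMr Hw (ext_powP c0)).
  case: j jlt => [//|j] jlt.
  exact: (xsfree (fun i => c i.+1) (fun i => cO i.+1)).
have cU : c 0%N \in unitO v by rewrite unitO_notin_powP.
have [|z zS Hz] := HS (fun i => - (c 0%N)^-1 * c i.+1).
  move=> i; rewrite mulNr (powPN Hv); apply: (powPMl Hv) => //.
  exact: (unitO_O (unitOV Hv cU)).
exists z => //.
rewrite (_ : y - z = (c 0%N)^-1 *: (c 0%N *: y + \sum_(i < size xs) c i.+1 *: xs`_i)
   + (\sum_(i < size xs) (- (c 0%N)^-1 * c i.+1) *: xs`_i - z)); last first.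
  rewrite scalerDr scalerA mulVf ?(unitO_nz cU) // scale1r scaler_sumr -addrA.
  congr (_ + _); rewrite addrA -big_split /= big1 ?add0r // => i _.
  by rewrite scalerA -scalerDl mulNr subrr scale0r.
apply: (powPD Hw) => //; rewrite -[_ *: _]mulr_algl; apply: (powPMl Hw) => //.
exact/ext_powP/(unitO_O (unitOV Hv cU)).
Qed.

End ResidueOfExtension.

Section ResidueOfQp.
Variables (p : nat) (Qp : fieldType) (vp : Qp -> int) (HQp : is_Qp p vp).

Let Hv := Qp_val HQp.

Lemma intr_powP1 (z : int) : (z%:~R \in powP vp 1) = (p %| `|z|)%N.
Proof.
have nat_case n : (n%:R \in powP vp 1) = (p %| n)%N.
  case: n => [|n]; first by rewrite dvdn0 (powP_0 vp 1).
  have [n0 vn] := Qp_nat HQp (ltn0Sn n).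
  by rewrite powP_nz // vn lez_nat logn_gt0 mem_primes (Qp_prime HQp).
by case: z => n; rewrite ?NegzE ?mulrNz ?(powPN Hv) -pmulrn nat_case ?abszN.
Qed.

Lemma intr_O (z : int) : z%:~R \in ringO vp.
Proof.
have nat_case n : n%:R \in ringO vp.
  case: n => [|n]; first exact: powP_0.
  by have [n0 vn] := Qp_nat HQp (ltn0Sn n); rewrite powP_nz // vn.
by case: z => n; rewrite ?NegzE ?mulrNz ?(powPN Hv) -pmulrn nat_case.
Qed.

(** Density of the rationals makes every residue class that of a fraction, and
    inverting the denominator modulo [p] makes it that of an integer. *)
Lemma finite_residue_Qp : finite_mod vp 1.
Proof.
have p0 : (p%:Z != 0) by rewrite eqz_nat -lt0n prime_gt0 ?(Qp_prime HQp).
exists [seq n%:R | n <- iota 0 p] => x hx.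
have [q xq] := Qp_dense HQp x 1.
have qO : ratr q \in ringO vp.
  by rewrite -(subKr x (ratr q)); apply: (powPB Hv) => //; apply: powPO xq.
have d0 : (denq q)%:~R != 0 :> Qp.
  rewrite -absz_denq -pmulrn; apply: (Qp_nat HQp _).1.
  by rewrite absz_gt0 denq_neq0.
have qE : ratr q * (denq q)%:~R = (numq q)%:~R :> Qp.
  by rewrite /ratr divfK.
have dU : ~~ (p %| `|denq q|)%N.
  apply/negP => pd; have : (numq q)%:~R \in powP vp 1.
    by rewrite -qE; apply: (powPMl Hv); rewrite ?intr_powP1.
  rewrite intr_powP1 => pn; have := coprime_num_den q.
  rewrite /coprime => /eqP e; have : (p %| gcdn `|numq q| `|denq q|)%N.
    by rewrite dvdn_gcd pn.
  by rewrite e Euclid_dvd1 ?(Qp_prime HQp).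
have [a [b ab]] := Bezoutz (denq q) p%:Z.
have ab1 : a * denq q + b * p%:Z = 1.
  rewrite ab /gcdz; congr Posz; apply/eqP; rewrite gcdnC -/(coprime _ _).
  by rewrite prime_coprime ?(Qp_prime HQp).
have pP : p%:R \in powP vp 1 by rewrite -[p%:R]/(p%:Z%:~R) intr_powP1 dvdnn.
pose c := (numq q * a)%R.
have [n nE] : exists n : nat, (c %% p)%Z = n.
  by exists `|(c %% p)%Z|%N; rewrite gez0_abs ?modz_ge0.
exists n%:R.
  apply: map_f; rewrite mem_iota /= -ltz_nat -nE ltz_pmod //.
  by rewrite ltz_nat prime_gt0 ?(Qp_prime HQp).
have cE : c%:~R = (c %/ p)%Z%:~R * p%:R + n%:R :> Qp.
  by rewrite {1}(divz_eq c p) nE rmorphD rmorphM.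
have abE : a%:~R * (denq q)%:~R = 1 - b%:~R * p%:R :> Qp.
  by apply/eqP; rewrite eq_sym subr_eq -[p%:R]/(p%:Z%:~R) -!rmorphM -rmorphD ab1.
have -> : x - n%:R = (x - ratr q) + (ratr q * b%:~R + (c %/ p)%Z%:~R) * p%:R.
  have -> : n%:R = ratr q * (a%:~R * (denq q)%:~R) - (c %/ p)%Z%:~R * p%:R :> Qp.
    by apply/eqP; rewrite eq_sym subr_eq addrC -cE rmorphM /= -qE mulrA mulrAC.
  rewrite abE; ring.
apply: (powPD Hv) => //; apply: (powPMl Hv) => //.
apply: (powPD Hv); last exact: intr_O.
by apply: (powPMl Hv) => //; apply: intr_O.
Qed.

End ResidueOfQp.

(** * Averages over the unit group *)

Section Mean.
Variables (K : fieldType) (v : K -> int) (Hv : normalized_valuation v).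

Definition higher_unit (n : nat) : {pred K} :=
  [pred u | (u \in unitO v) && (u - 1 \in powP v n)].

Lemma higher_unitO n u : u \in higher_unit n -> u \in unitO v.
Proof. by case/andP. Qed.

Lemma higher_unitM n x y :
  x \in higher_unit n -> y \in higher_unit n -> x * y \in higher_unit n.
Proof.
move=> /andP[hx x1] /andP[hy y1]; rewrite inE unitOM //=.
rewrite (_ : x * y - 1 = x * (y - 1) + (x - 1)); last by ring.
by apply: (powPD Hv) => //; rewrite powP_unitM.
Qed.

Lemma higher_unitV n x : x \in higher_unit n -> x^-1 \in higher_unit n.
Proof.
move=> /andP[hx x1]; rewrite inE unitOV //=.
rewrite -(powP_unitM Hv _ _ hx) mulrBr divff ?(unitO_nz hx) // mulr1 -opprB.
by rewrite (powPN Hv).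
Qed.

Lemma higher_unitW m n x : (m <= n)%N -> x \in higher_unit n -> x \in higher_unit m.
Proof. by move=> mn /andP[hx x1]; rewrite inE hx (powPW mn). Qed.

Lemma higher_unit_sym n x y : x / y \in higher_unit n -> y / x \in higher_unit n.
Proof. by move/higher_unitV; rewrite invf_div. Qed.

Lemma higher_unit_trans n x y z : y != 0 ->
  x / y \in higher_unit n -> y / z \in higher_unit n -> x / z \in higher_unit n.
Proof. by move=> y0 /higher_unitM h /h; rewrite mulrA divfK. Qed.

Definition unit_reps (n N : nat) (t : 'I_N -> K) : Prop :=
  (forall i, t i \in unitO v) /\
  (forall u, u \in unitO v -> exists! i, u / t i \in higher_unit n).

Lemma unit_reps_exist n : finite_mod v 1 -> exists N (t : 'I_N -> K), unit_reps n t.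
Proof.
move=> /(finite_mod_all Hv) Hfin.
(* Representatives modulo [P^n.+1]: a residue modulo [P^0] would not detect units. *)
have [T HT] := Hfin n.+1.
have [S [SU Scov]] : exists S : seq K, {subset S <= unitO v} /\
    forall u, u \in unitO v -> has (fun t => u / t \in higher_unit n) S.
  exists [seq t <- T | t \in unitO v]; split.
    by move=> t; rewrite mem_filter => /andP[].
  move=> u hu; have [t tT ut] := HT u (unitO_O hu).
  have tU : t \in unitO v.
    by rewrite -(subKr u t); apply: (unitOD Hv (n := n.+1)); rewrite ?(powPN Hv).
  apply/hasP; exists t; rewrite ?mem_filter ?tU //.
  rewrite inE unitO_div //= -(powP_unitM Hv _ _ tU) mulrBr mulrCA divff ?(unitO_nz tU) //.
  by rewrite !mulr1; apply: powPW ut.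
have [S' [SU' Scov' Spw]] : exists S' : seq K, [/\ {subset S' <= unitO v},
    forall u, u \in unitO v -> has (fun t => u / t \in higher_unit n) S ->
      has (fun t => u / t \in higher_unit n) S'
    & pairwise (fun x y => x / y \notin higher_unit n) S'].
  elim: S SU {Scov} => [_|x S IH SU]; first by exists [::]; split.
  have [t tS|S' [SU' Scov' Spw]] := IH; first by apply: SU; rewrite inE tS orbT.
  have [hx|hx] := boolP (has (fun t => x / t \in higher_unit n) S').
    exists S'; split=> // u hu /= /orP[ux|]; last exact: Scov'.
    case/hasP: hx => y yS xy; apply/hasP; exists y => //.
    apply: higher_unit_trans ux xy; apply: (@unitO_nz _ v); apply: SU.
    by rewrite mem_head.
  exists (x :: S'); split.
  - move=> t; rewrite inE => /orP[/eqP->|]; last exact: SU'.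
    by apply: SU; rewrite mem_head.
  - by move=> u hu /= /orP[->//|/(Scov' _ hu) ->]; rewrite orbT.
  - by rewrite /= Spw andbT all_predC.
exists (size S'), (fun i => S'`_i); split=> [i|u hu].
  by apply/SU'/mem_nth.
have := Scov' u hu (Scov u hu); case/(hasP) => t tS ut.
have tlt : (index t S' < size S')%N by rewrite index_mem.
exists (Ordinal tlt); split; first by rewrite /= nth_index.
move=> j uj; apply/val_inj => /=.
have : t / S'`_j \in higher_unit n.
  by apply: (higher_unit_trans (unitO_nz hu)) uj; apply: higher_unit_sym.
rewrite -{1}(nth_index 0 tS) => /[dup] /higher_unit_sym.
move/(pairwiseP 0): Spw => Spw.
case: (ltngtP (index t S') j) => // ij.
- by have := Spw _ _ tlt (ltn_ord j) ij => /negbTE ->.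
- by have := Spw _ _ (ltn_ord j) tlt ij => /negbTE ->.
Qed.

Variable C : numFieldType.
Implicit Types g : K -> C.

Definition unit_smooth n g : Prop :=
  forall u y, u \in unitO v -> y \in higher_unit n -> g (u * y) = g u.

Lemma unit_smoothW m n g : (m <= n)%N -> unit_smooth m g -> unit_smooth n g.
Proof. by move=> mn Hg u y hu /(higher_unitW mn); apply: Hg. Qed.

Definition reps_mean N (t : 'I_N -> K) g : C := N%:R^-1 * \sum_i g (t i).

Lemma reps_gt0 n N (t : 'I_N -> K) : unit_reps n t -> (0 < N)%N.
Proof.
by case=> _ /(_ _ (unitO1 Hv)) [i _]; apply: leq_ltn_trans (ltn_ord i).
Qed.

(** Translation by a unit permutes the classes modulo the higher unit group. *)
Lemma reps_mean_translate n N (t : 'I_N -> K) g h :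
    unit_reps n t -> unit_smooth n g -> h \in unitO v ->
  reps_mean t (fun u => g (u * h)) = reps_mean t g.
Proof.
move=> [tU tcov] Hg hU.
have /choice[s Hs] (i : 'I_N) : exists j, t i * h / t j \in higher_unit n.
  by have [j [Hj _]] := tcov (t i * h) (unitOM Hv (tU i) hU); exists j.
have s_inj : injective s.
  move=> i j sij; have := Hs j; rewrite -sij => /higher_unit_sym Hj.
  have Hij : t i / t j \in higher_unit n.
    have := higher_unit_trans (unitO_nz (tU (s i))) (Hs i) Hj.
    by rewrite -mulf_div divff ?(unitO_nz hU) // mulr1.
  have [k [_ Hk]] := tcov (t i) (tU i); rewrite -(Hk j Hij); apply/esym/Hk.
  by rewrite divff ?(unitO_nz (tU i)) // inE unitO1 //= subrr powP_0.
rewrite /reps_mean; congr (_ * _); rewrite [RHS](reindex_inj s_inj) /=.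
apply: eq_bigr => i _.
by rewrite -(Hg (t (s i)) (t i * h / t (s i))) // [t (s i) * _]mulrC divfK // (unitO_nz (tU (s i))).
Qed.

(** Both sides equal the average of [g] over all products of a member of one
    system with a member of the other. *)
Lemma reps_mean_unique n1 N1 (t1 : 'I_N1 -> K) n2 N2 (t2 : 'I_N2 -> K) g :
    unit_reps n1 t1 -> unit_smooth n1 g -> unit_reps n2 t2 -> unit_smooth n2 g ->
  reps_mean t1 g = reps_mean t2 g.
Proof.
move=> H1 S1 H2 S2.
have N1_0 : N1%:R != 0 :> C by rewrite pnatr_eq0 -lt0n (reps_gt0 H1).
have N2_0 : N2%:R != 0 :> C by rewrite pnatr_eq0 -lt0n (reps_gt0 H2).
have E1 : reps_mean t2 (fun y => reps_mean t1 (fun x => g (x * y))) = reps_mean t1 g.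
  rewrite {1}/reps_mean (eq_bigr (fun=> reps_mean t1 g)) => [|j _].
    by rewrite sumr_const card_ord -[X in _ * X]mulr_natl mulKf.
  exact: (reps_mean_translate H1 S1 (H2.1 j)).
have E2 : reps_mean t1 (fun x => reps_mean t2 (fun y => g (y * x))) = reps_mean t2 g.
  rewrite {1}/reps_mean (eq_bigr (fun=> reps_mean t2 g)) => [|j _].
    by rewrite sumr_const card_ord -[X in _ * X]mulr_natl mulKf.
  exact: (reps_mean_translate H2 S2 (H1.1 j)).
rewrite -E1 -E2 /reps_mean -!mulr_sumr mulrCA; congr (_ * (_ * _)).
rewrite exchange_big; apply: eq_bigr => i _; apply: eq_bigr => j _.
by rewrite mulrC.
Qed.

(** The integral of a smooth function over [O^*], for the invariant measure of
    total mass 1. *)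
Definition mean g : C := xget 0 [set c | exists n N (t : 'I_N -> K),
  [/\ unit_reps n t, unit_smooth n g & c = reps_mean t g]]%classic.

Lemma meanE n N (t : 'I_N -> K) g :
  unit_reps n t -> unit_smooth n g -> mean g = reps_mean t g.
Proof.
move=> Ht Hg; apply: xget_unique; first by exists n, N, t.
by move=> c [n' [N' [t' [Ht' Hg' ->]]]]; exact: (reps_mean_unique Ht' Hg' Ht Hg).
Qed.

Hypothesis Hfin : finite_mod v 1.

Lemma mean_linear n a f g : unit_smooth n f -> unit_smooth n g ->
  mean (fun u => a * f u + g u) = a * mean f + mean g.
Proof.
move=> Hf Hg; have [N [t Ht]] := unit_reps_exist n Hfin.
rewrite !(meanE Ht) //; last by move=> u y hu hy; rewrite Hf ?Hg.
by rewrite /reps_mean big_split -mulr_sumr mulrDr mulrCA.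
Qed.

Lemma mean_translate n g h : unit_smooth n g -> h \in unitO v ->
  mean (fun u => g (u * h)) = mean g.
Proof.
move=> Hg hU; have [N [t Ht]] := unit_reps_exist n Hfin.
rewrite !(meanE Ht) //; last by move=> u y hu hy /=; rewrite mulrAC (Hg (u * h)) ?(unitOM Hv).
exact: (reps_mean_translate Ht Hg hU).
Qed.

Lemma mean_ext n f g : unit_smooth n g -> (forall u, u \in unitO v -> f u = g u) ->
  mean f = mean g.
Proof.
move=> Hg fg; have [N [t Ht]] := unit_reps_exist n Hfin.
rewrite !(meanE Ht) //; last first.
  by move=> u y hu hy; rewrite !fg ?Hg // (unitOM Hv) // (higher_unitO hy).
by congr (_ * _); apply: eq_bigr => i _; rewrite fg ?Ht.1.
Qed.

Lemma mean_scale n a g : unit_smooth n g -> mean (fun u => a * g u) = a * mean g.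
Proof.
move=> Hg; have [N [t Ht]] := unit_reps_exist n Hfin.
rewrite !(meanE Ht) //; last by move=> u y hu hy; rewrite Hg.
by rewrite /reps_mean -mulr_sumr mulrCA.
Qed.

(** One of the representatives lies in the class of 1, hence in [A]. *)
Lemma mean_indicator_neq0 n (A : {pred K}) :
    unit_smooth n (fun u => (u \in A)%:R) -> {subset higher_unit n <= A} ->
  mean (fun u => (u \in A)%:R) != 0.
Proof.
move=> HA An; have [N [t Ht]] := unit_reps_exist n Hfin.
rewrite (meanE Ht) // mulf_neq0 ?invr_eq0 ?pnatr_eq0 -?lt0n ?(reps_gt0 Ht) //.
have [i [Hi _]] := Ht.2 _ (unitO1 Hv).
rewrite psumr_neq0 => [|j _]; last exact: ler0n.
apply/hasP; exists i; rewrite ?mem_index_enum //= ltr0n lt0b An //.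
by move/higher_unitV: Hi; rewrite div1r invrK.
Qed.

End Mean.

(** * Two by two matrices over the ring of integers *)

Section Matrices.
Variables (F : fieldType) (v : F -> int) (Hv : normalized_valuation v).
Implicit Types (A B x k : 'M[F]_2).

Lemma ord2_cases (i : 'I_2) : i = 0 \/ i = 1.
Proof. by case: i => [[|[|//]] hi]; [left|right]; apply/val_inj. Qed.

Lemma mul2E A B i j : (A *m B) i j = A i 0 * B 0 j + A i 1 * B 1 j.
Proof.
rewrite mxE !big_ord_recl big_ord0 addr0.
by rewrite (_ : lift ord0 ord0 = 1) //; apply/val_inj.
Qed.

Lemma det2E A : \det A = A 0 0 * A 1 1 - A 0 1 * A 1 0.
Proof.
rewrite (expand_det_row _ ord0) !big_ord_recl big_ord0 addr0 /cofactor !det_mx11.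
rewrite !mxE /= expr0 mul1r expr1 mulN1r mulrN.
by congr (A _ _ * A _ _ - A _ _ * A _ _); apply/val_inj.
Qed.

Lemma mx2_eqP A B : A 0 0 = B 0 0 -> A 0 1 = B 0 1 -> A 1 0 = B 1 0 ->
  A 1 1 = B 1 1 -> A = B.
Proof.
move=> h1 h2 h3 h4; apply/matrixP => i j.
by case: (ord2_cases i) => ->; case: (ord2_cases j) => ->.
Qed.

Definition mx2 (a b c d : F) : 'M[F]_2 :=
  \matrix_(i, j) (if i == 0 then if j == 0 then a else b
                  else if j == 0 then c else d).

Lemma mx2_00 a b c d : mx2 a b c d 0 0 = a. Proof. by rewrite mxE. Qed.
Lemma mx2_01 a b c d : mx2 a b c d 0 1 = b. Proof. by rewrite mxE. Qed.
Lemma mx2_10 a b c d : mx2 a b c d 1 0 = c. Proof. by rewrite mxE. Qed.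
Lemma mx2_11 a b c d : mx2 a b c d 1 1 = d. Proof. by rewrite mxE. Qed.
Definition mx2_entry := (mx2_00, mx2_01, mx2_10, mx2_11).

Lemma GL2OP k : reflect ((forall i j, k i j \in ringO v) /\ \det k \in unitO v)
  (k \in GL2O v).
Proof.
apply: (iffP andP) => [[/forallP h d]|[h d]]; split=> //.
  by move=> i j; move/forallP: (h i); apply.
by apply/forallP => i; apply/forallP.
Qed.

Lemma GL2O_mx2 a b c d : a \in ringO v -> b \in ringO v -> c \in ringO v ->
  d \in ringO v -> a * d - b * c \in unitO v -> mx2 a b c d \in GL2O v.
Proof.
move=> ha hb hc hd hu; apply/GL2OP; split; last by rewrite det2E !mx2_entry.
by move=> i j; case: (ord2_cases i) => ->; case: (ord2_cases j) => ->; rewrite !mx2_entry.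
Qed.

Lemma GL2O_entry k i j : k \in GL2O v -> k i j \in ringO v.
Proof. by case/GL2OP. Qed.

Lemma GL2O_det k : k \in GL2O v -> \det k \in unitO v.
Proof. by case/GL2OP. Qed.

Lemma GL2O_unitmx k : k \in GL2O v -> k \in unitmx.
Proof. by move/GL2O_det/unitO_nz => h; rewrite unitmxE unitfE. Qed.

Lemma GL2OM x k : x \in GL2O v -> k \in GL2O v -> x *m k \in GL2O v.
Proof.
move=> /GL2OP[hx dx] /GL2OP[hk dk]; apply/GL2OP; split.
  by move=> i j; rewrite mul2E; apply: (powPD Hv); apply: (powPMl Hv).
by rewrite det_mulmx (unitOM Hv).
Qed.

Definition inv2 k : 'M[F]_2 :=
  mx2 (k 1 1 / \det k) (- k 0 1 / \det k) (- k 1 0 / \det k) (k 0 0 / \det k).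

Lemma mul2V k : \det k != 0 -> k *m inv2 k = 1%:M.
Proof.
move=> d0; have := d0; rewrite /inv2 det2E => dE.
by apply: mx2_eqP; rewrite !mul2E !mx2_entry !mxE /=; field.
Qed.

Lemma inv2_mul k : \det k != 0 -> inv2 k *m k = 1%:M.
Proof.
move=> d0; have := d0; rewrite /inv2 det2E => dE.
by apply: mx2_eqP; rewrite !mul2E !mx2_entry !mxE /=; field.
Qed.

Lemma GL2OV k : k \in GL2O v -> inv2 k \in GL2O v.
Proof.
move=> hk; have dk := GL2O_det hk; have dV := unitO_O (unitOV Hv dk).
have hkN i j : - k i j \in ringO v by rewrite (powPN Hv) GL2O_entry.
apply: GL2O_mx2; try by apply: (powPMl Hv) => //; apply: GL2O_entry.
set e := (_ - _); suff -> : e = (\det k)^-1 by apply: unitOV.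
have := unitO_nz dk; rewrite /e det2E => d0; field; exact: d0.
Qed.

Lemma BgrpP m k : reflect (k \in GL2O v /\ k 1 0 \in powP v m) (k \in Bgrp v m).
Proof. exact: andP. Qed.

Lemma BgrpW m n k : (m <= n)%N -> k \in Bgrp v n -> k \in Bgrp v m.
Proof. by move=> mn /BgrpP[hk k10]; apply/BgrpP; split=> //; apply: powPW k10. Qed.

Lemma Bgrp_diag m k : (0 < m)%N -> k \in Bgrp v m ->
  k 0 0 \in unitO v /\ k 1 1 \in unitO v.
Proof.
move=> m0 /BgrpP[hk k10].
have hU : k 0 0 * k 1 1 \in unitO v.
  rewrite (_ : _ * _ = \det k + k 0 1 * k 1 0); last by rewrite det2E subrK.
  apply: (unitOD Hv m0); first exact: GL2O_det.
  by apply: (powPMl Hv) => //; apply: GL2O_entry.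
split; first by apply: (unitO_factor Hv) hU; apply: GL2O_entry.
by rewrite mulrC in hU; apply: (unitO_factor Hv) hU; apply: GL2O_entry.
Qed.

Lemma Bgrp_mulr m x k : (0 < m)%N -> x \in GL2O v -> k \in Bgrp v m ->
  (x *m k \in Bgrp v m) = (x \in Bgrp v m).
Proof.
move=> m0 hx hk; have [k00 _] := Bgrp_diag m0 hk; have /BgrpP[hk' k10] := hk.
rewrite ![_ \in Bgrp v m]inE hx GL2OM //= mul2E.
have hp : x 1 1 * k 1 0 \in powP v m by apply: (powPMl Hv) => //; apply: GL2O_entry.
rewrite -[RHS](powP_unitM Hv _ _ k00) [k 0 0 * _]mulrC.
by apply/idP/idP => h; [rewrite -(addrK (x 1 1 * k 1 0) (_ * _)); apply: powPB|apply: powPD].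
Qed.

Lemma Bgrp_mull m (b : 'M[F]_2) x : (0 < m)%N -> b \in Bgrp v m -> x \in GL2O v ->
  (b *m x \in Bgrp v m) = (x \in Bgrp v m).
Proof.
move=> m0 hb hx; have [_ b11] := Bgrp_diag m0 hb; have /BgrpP[hb' b10] := hb.
rewrite ![_ \in Bgrp v m]inE hx GL2OM //= mul2E.
have hp : b 1 0 * x 0 0 \in powP v m by apply: (powPMr Hv) => //; apply: GL2O_entry.
rewrite -[RHS](powP_unitM Hv _ _ b11).
by apply/idP/idP => h; [rewrite -(addKr (b 1 0 * x 0 0) (_ * _)) addrC; apply: powPB|apply: powPD].
Qed.

Definition lower (c : F) : 'M[F]_2 := mx2 1 0 c 1.

Lemma lower_Bgrp m c : c \in powP v m -> lower c \in Bgrp v m.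
Proof.
move=> hc; apply/BgrpP; rewrite mx2_10; split=> //.
apply: GL2O_mx2; rewrite ?(powP_0 v 0) ?(unitO_O (unitO1 Hv)) //.
  exact: powPO hc.
by rewrite mulr1 mul0r subr0 unitO1.
Qed.

Lemma diag_Bgrp m e : e \in unitO v -> mx2 1 0 0 e \in Bgrp v m.
Proof.
move=> he; apply/BgrpP; rewrite mx2_10 powP_0; split=> //.
apply: GL2O_mx2; rewrite ?(powP_0 v 0) ?(unitO_O (unitO1 Hv)) ?(unitO_O he) //.
by rewrite mul1r mul0r subr0.
Qed.

End Matrices.

(** * Eigenvectors as functions of the lower left entry *)

Section Eigenvectors.
Variables (F : fieldType) (v : F -> int) (Hv : normalized_valuation v).
Variables (C : fieldType) (nu : F -> C) (r : nat).
Hypotheses (Hnu : mul_char nu) (Hr : conductor v nu r) (r_gt0 : (0 < r)%N).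
Implicit Types (x k b : 'M[F]_2) (psi : F -> C) (f : 'M[F]_2 -> C).

Lemma nu_unitM (x y : F) : x \in unitO v -> y \in unitO v -> nu (x * y) = nu x * nu y.
Proof. by move=> hx hy; rewrite Hnu.2 ?(unitO_nz hx) ?(unitO_nz hy). Qed.

Lemma nu_congr (x y : F) : x \in unitO v -> x - y \in powP v r -> nu x = nu y.
Proof.
move=> hx xy; have hy : y \in unitO v.
  by rewrite -(subKr x y); apply: (unitOD Hv r_gt0) => //; rewrite (powPN Hv).
rewrite -{1}(divfK (unitO_nz hy) x) nu_unitM ?unitO_div // Hr.1 ?mul1r ?unitO_div //.
rewrite -(powP_unitM Hv _ _ hy) mulrBr mulrCA divff ?(unitO_nz hy) //.
by rewrite !mulr1.
Qed.

(** By [eigenvector_section], the general form on [GL_2(O)] of a function that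
    transforms by [nu] on the left under upper triangular matrices and on the
    right under [B(m)]. *)
Definition section psi : 'M[F]_2 -> C :=
  fun x => if x \in Bgrp v r then nu (x 0 0) * psi (x 1 0) else 0.

(** [psi c] depends only on the smaller of [m] and the valuation of [c]. *)
Definition radial m psi : Prop := forall c e d, c \in ringO v ->
  e \in unitO v -> d \in powP v m -> psi (e * c + d) = psi c.

Lemma section_mulr m psi x k : (r <= m)%N -> radial m psi ->
  x \in GL2O v -> k \in Bgrp v m -> section psi (x *m k) = nu (k 0 0) * section psi x.
Proof.
move=> rm Hpsi hx hk; have hkr := BgrpW rm hk.
have [k00 k11] := Bgrp_diag Hv r_gt0 hkr.
have /BgrpP[hkG k10] := hk.
rewrite /section (Bgrp_mulr Hv) //; case: ifPn => [hxr|_]; last by rewrite mulr0.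
have [x00 x11] := Bgrp_diag Hv r_gt0 hxr; have /BgrpP[_ x10] := hxr.
rewrite !mul2E mulrA; congr (_ * _).
  rewrite -nu_unitM //; apply/esym/nu_congr; rewrite ?unitOM //.
  rewrite mulrC opprD addrA subrr add0r (powPN Hv).
  by apply: (powPMl Hv); [exact: GL2O_entry|exact: powPW k10].
rewrite [x 1 0 * _]mulrC Hpsi ?(GL2O_entry _ _ hx) //.
by apply: (powPMl Hv) => //; apply: GL2O_entry.
Qed.

Lemma section_mull m psi b x : (r <= m)%N -> radial m psi ->
  b \in Bgrp v m -> x \in GL2O v -> section psi (b *m x) = nu (b 0 0) * section psi x.
Proof.
move=> rm Hpsi hb hx; have hbr := BgrpW rm hb.
have [b00 b11] := Bgrp_diag Hv r_gt0 hbr.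
have /BgrpP[hbG b10] := hb.
rewrite /section (Bgrp_mull Hv) //; case: ifPn => [hxr|_]; last by rewrite mulr0.
have [x00 x11] := Bgrp_diag Hv r_gt0 hxr; have /BgrpP[_ x10] := hxr.
rewrite !mul2E mulrA; congr (_ * _).
  rewrite -nu_unitM //; apply/esym/nu_congr; rewrite ?unitOM //.
  rewrite opprD addrA subrr add0r (powPN Hv).
  by apply: (powPMl Hv) => //; apply: GL2O_entry.
rewrite addrC Hpsi ?(GL2O_entry _ _ hx) //.
by apply: (powPMr Hv) => //; apply: GL2O_entry.
Qed.

Variables (m : nat) (f : 'M[F]_2 -> C).
Hypotheses
  (f_mull : forall b x, b \in GL2O v -> b 1 0 = 0 -> x \in GL2O v ->
     f (b *m x) = nu (b 0 0) * f x)
  (f_mulr : forall k x, k \in Bgrp v m -> f (x *m k) = nu (k 0 0) * f x).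

(** If [x 1 0] has valuation [i < r], choose a unit [y] congruent to 1 modulo
    [P^i] with [nu y != 1]. There is an upper triangular [b] with diagonal
    [(1, y)] for which the first column of [b *m x] is [y] times that of [x];
    then [b *m x = x *m k] with [k] upper triangular and [k 0 0 = y], and the
    two equivariance properties give [f x = nu y * f x]. *)
Lemma eigenvector_support x : x \in GL2O v -> x \notin Bgrp v r -> f x = 0.
Proof.
move=> hx hxB.
have x10 : x 1 0 \notin powP v r by apply: contra hxB => h; apply/BgrpP.
have c0 : x 1 0 != 0 by apply: contra x10 => /eqP ->; exact: powP_0.
have [i vi] : exists i : nat, v (x 1 0) = i.
  have := GL2O_entry 1 0 hx; rewrite powP_nz // => h.
  by exists (absz (v (x 1 0))); rewrite gez0_abs.
have [y [hy y1 nuy]] : exists y,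
    [/\ y \in unitO v, y - 1 \in powP v i & nu y != 1].
  apply: contrapT => hN; have /Hr.2 : forall y, y \in unitO v ->
      y - 1 \in powP v i -> nu y = 1.
    move=> y hy y1; apply/eqP/negPn/negP => nuy; apply: hN; exists y; split=> //.
  by move: x10; rewrite powP_nz // vi lez_nat => /negbTE ->.
pose b := mx2 1 ((y - 1) / x 1 0 * x 0 0) 0 y.
have hb : b \in GL2O v.
  apply: GL2O_mx2; rewrite ?(powP_0 v 0) ?(unitO_O (unitO1 Hv)) ?(unitO_O hy) //.
    apply: (powPMl Hv); last exact: GL2O_entry.
    by apply: (div_powP Hv y1); rewrite powP_nz // vi; apply/negP; rewrite lez_nat ltnn.
  by rewrite mulr0 subr0 mul1r.
have dx := unitO_nz (GL2O_det hx).
pose k := inv2 x *m (b *m x).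
have bx : b *m x = x *m k by rewrite /k mulmxA mul2V // mul1mx.
have dx' := dx; rewrite det2E in dx'.
have k00 : k 0 0 = y.
  by rewrite /k !mul2E /inv2 det2E !mx2_entry; field; rewrite c0 dx'.
have k10 : k 1 0 = 0.
  by rewrite /k !mul2E /inv2 det2E !mx2_entry; field; rewrite c0 dx'.
have hk : k \in Bgrp v m.
  apply/BgrpP; rewrite k10 powP_0; split=> //.
  by apply: GL2OM => //; [exact: GL2OV|exact: GL2OM].
have := f_mulr x hk; rewrite -bx f_mull ?mx2_entry // Hnu.1 mul1r k00 => e.
apply/eqP; have : (1 - nu y) * f x == 0 by rewrite mulrBl mul1r -e subrr.
by rewrite mulf_eq0 subr_eq0 eq_sym (negbTE nuy).
Qed.

(** A matrix in [B(r)] is upper triangular times lower unipotent times diagonal,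
    and [nu] takes the same value at the upper left entries of the matrix and of
    the first factor, since these are congruent modulo [P^r]. *)
Lemma eigenvector_section x : x \in GL2O v ->
  f x = section (fun c => f (lower c)) x.
Proof.
move=> hx; rewrite /section; case: ifPn => [hxB|]; last exact: eigenvector_support.
have [x00 x11] := Bgrp_diag Hv r_gt0 hxB; have /BgrpP[_ x10] := hxB.
have p10 : x 0 1 * x 1 0 \in powP v r by apply: (powPMl Hv) => //; apply: GL2O_entry.
have p10' : x 0 1 / x 1 1 * x 1 0 \in powP v r.
  by rewrite mulrAC; apply: (powPMr Hv p10); apply/unitO_O/unitOV.
pose b := mx2 (x 0 0 - x 0 1 / x 1 1 * x 1 0) (x 0 1 / x 1 1) 0 1.
have bU : x 0 0 - x 0 1 / x 1 1 * x 1 0 \in unitO v.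
  by apply: (unitOD Hv r_gt0) => //; rewrite (powPN Hv).
have hb : b \in GL2O v.
  apply: GL2O_mx2; rewrite ?(powP_0 v 0) ?(unitO_O (unitO1 Hv)) ?(unitO_O bU) //.
    by apply: (powPMl Hv); [exact: GL2O_entry|apply/unitO_O/unitOV].
  by rewrite mulr0 subr0 mulr1.
have hl : lower (x 1 0) \in GL2O v by have /BgrpP[] := lower_Bgrp Hv x10.
have xE : x = b *m lower (x 1 0) *m mx2 1 0 0 (x 1 1).
  have x11_0 := unitO_nz x11.
  by apply: mx2_eqP; rewrite !mul2E !mx2_entry; field.
rewrite {1}xE f_mulr ?diag_Bgrp // mx2_entry Hnu.1 mul1r f_mull ?mx2_entry //.
congr (_ * _); apply: nu_congr => //.
by rewrite addrC addKr (powPN Hv).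
Qed.

(** Conjugation by [diag(1, e)] multiplies [c] by [e], and translation by the lower
    unipotents in [B(m)] adds an element of [P^m]. *)
Lemma eigenvector_radial : radial m (fun c => f (lower c)).
Proof.
move=> c e d hc he hd.
have hl n c' : c' \in powP v n -> lower c' \in GL2O v.
  by move=> h; have /BgrpP[] := lower_Bgrp Hv h.
have -> : lower (e * c + d) = lower (e * c) *m lower d.
  by apply: mx2_eqP; rewrite !mul2E !mx2_entry; ring.
rewrite f_mulr ?lower_Bgrp // mx2_entry Hnu.1 mul1r.
have -> : lower (e * c) = mx2 1 0 0 e *m lower c *m mx2 1 0 0 e^-1.
  have e0 := unitO_nz he.
  by apply: mx2_eqP; rewrite !mul2E !mx2_entry; field.
rewrite f_mulr ?diag_Bgrp ?unitOV // mx2_entry Hnu.1 mul1r f_mull ?mx2_entry //.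
- by rewrite Hnu.1 mul1r.
- by have /BgrpP[] := diag_Bgrp Hv 0 he.
- exact: (hl 0%N).
Qed.

End Eigenvectors.

(** * The unramified torus *)

Section Torus.
Variables (F : fieldType) (v : F -> int) (Hv : normalized_valuation v).
Variables (K : fieldExtType F) (vK : K -> int).
Hypothesis HK : unramified_quadratic v vK.
Variable iota : {lrmorphism K -> 'M[F]_2}.
Hypothesis Hiota : forall u : K, u \in unitO vK -> iota u \in GL2O v.

Let HvK : normalized_valuation vK. Proof. by case: HK. Qed.

Lemma alg_powP n a : (a%:A \in powP vK n) = (a \in powP v n).
Proof.
have [->|a0] := eqVneq a 0; first by rewrite scale0r !(powP_0 _ n).
by case: HK => _ Hext _; rewrite !powP_nz ?scaler_eq0 ?negb_or ?a0 ?oner_neq0 // Hext.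
Qed.

Lemma alg_neq0 (a : F) : a != 0 -> a%:A != 0 :> K.
Proof. by move=> a0; rewrite scaler_eq0 negb_or a0 oner_neq0. Qed.

Lemma alg_unitO a : a \in unitO v -> a%:A \in unitO vK.
Proof.
move=> ha; rewrite inE alg_neq0 ?(unitO_nz ha) //=.
by case: HK => _ Hext _; rewrite Hext ?(unitO_nz ha) // unitO_val.
Qed.

Lemma iota_alg a : iota a%:A = a%:M.
Proof. by rewrite linearZ /= rmorph1 scalemx1. Qed.

(** A nonunit [y] is the difference of the units [1 + y] and 1. *)
Lemma iota_O y i j : y \in ringO vK -> iota y i j \in ringO v.
Proof.
move=> hy; have [hu|/negbTE hu] := boolP (y \in unitO vK).
  exact/GL2O_entry/Hiota.
have y1 : y \in powP vK 1 by apply: contraFT hu => h; rewrite unitO_notin_powP.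
have : 1 + y \in unitO vK by apply: (unitOD HvK _ (unitO1 HvK) y1).
move=> /Hiota /(GL2O_entry i j); rewrite rmorphD rmorph1 !mxE => h.
rewrite -(addKr (i == j)%:R (iota y i j)) addrC.
by apply: (powPB Hv h); case: (i == j); rewrite ?(powP_0 v 0) ?(unitO_O (unitO1 Hv)).
Qed.

Lemma iota_unitmx k : k != 0 -> iota k \in unitmx.
Proof.
move=> k0; have : iota k *m iota k^-1 = 1%:M.
  by rewrite -[_ *m _]/(iota k * iota k^-1) -rmorphM divff // rmorph1.
by case/mulmx1_unit.
Qed.

Lemma iota_det_neq0 k : k != 0 -> \det (iota k) != 0.
Proof. by move/iota_unitmx; rewrite unitmxE unitfE. Qed.

Lemma scale_factor k : k != 0 ->
  exists a u, [/\ a != 0, u \in unitO vK, k = a *: u & v a = vK k].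
Proof.
move=> k0; have [w w0 vw] := uniformizer_exists Hv.
have [a a0 va] : exists2 a, a != 0 & v a = vK k.
  case: (vK k) => n.
    by exists (w ^+ n); rewrite ?expf_neq0 // valuationX // vw natz.
  exists (w ^- n.+1); rewrite ?invr_eq0 ?expf_neq0 // valuationV ?expf_neq0 // valuationX // vw.
  by rewrite NegzE natz.
exists a, (a^-1 *: k); split=> //; last by rewrite scalerA divff // scale1r.
have aV : a^-1 != 0 by rewrite invr_eq0.
rewrite inE scaler_eq0 negb_or aV k0 /= -mulr_algl.
case: HK => _ Hext _.
by rewrite (valuationM HvK) ?alg_neq0 // Hext // (valuationV Hv) // va addNr.
Qed.

Lemma powP_factor n y : y \in powP vK n ->
  exists a z, [/\ a \in powP v n, z \in ringO vK & y = a *: z].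
Proof.
have [->|y0] := eqVneq y 0.
  exists 0, 0; split; [exact: powP_0|exact: powP_0|by rewrite scaler0].
rewrite powP_nz // => hy; have [a [z [a0 hz yE va]]] := scale_factor y0.
by exists a, z; split=> //; [by rewrite powP_nz // va|exact: unitO_O].
Qed.

Lemma iota_higher_unit n u : u \in higher_unit vK n ->
  iota u \in principal_congruence v n.
Proof.
move=> /andP[hu /powP_factor[a [z [ha hz e]]]].
rewrite inE Hiota //=; apply/forallP => i; apply/forallP => j.
have -> : u = a *: z + 1 by rewrite -e subrK.
rewrite rmorphD rmorph1 /= linearZ /= !mxE addrK.
by apply: (powPMr Hv ha); apply: iota_O.
Qed.

Lemma congruence_Bgrp n k : k \in principal_congruence v n ->
  k \in Bgrp v n /\ k 0 0 - 1 \in powP v n.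
Proof.
case/andP=> hk /forallP h; split.
  apply/BgrpP; split=> //.
  by have := forallP (h 1) 0; rewrite subr0.
exact: (forallP (h 0) 0).
Qed.

(** With [w := u - a] and [a] the upper left entry of [iota u], the matrix
    [iota w] has a zero in the upper left corner; its determinant is a unit
    times a square, so its lower left entry has the valuation of [w]. *)
Lemma iota_lower_left m u : u \in unitO vK -> iota u 1 0 \in powP v m ->
  u - (iota u 0 0)%:A \in powP vK m.
Proof.
move=> hu h10; set w := u - _.
have iw00 : iota w 0 0 = 0 by rewrite rmorphB /= iota_alg !mxE subrr.
have iw10 : iota w 1 0 = iota u 1 0 by rewrite rmorphB /= iota_alg !mxE subr0.
have [->|w0] := eqVneq w 0; first exact: powP_0.
have [a [z [a0 hz wE va]]] := scale_factor w0.
have iz i j : iota w i j = a * iota z i j by rewrite wE linearZ /= mxE.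
have z00 : iota z 0 0 = 0.
  by apply/eqP; have := iz 0 0; rewrite iw00 => /esym/eqP; rewrite mulf_eq0 (negbTE a0).
have hzG := Hiota hz.
have z10 : iota z 1 0 \in unitO v.
  apply: (unitO_factor Hv (y := - iota z 0 1)).
  - exact: GL2O_entry.
  - by rewrite (powPN Hv) GL2O_entry.
  by rewrite mulrN mulrC; have := GL2O_det hzG; rewrite det2E z00 mul0r sub0r.
rewrite powP_nz // -va -powP_nz // -(powP_unitM Hv _ _ z10) mulrC -iz iw10.
exact: h10.
Qed.

(** The lower row of [iota] is an isomorphism from [K] to [F^2]: an element [th]
    outside the line of 1 has a nonzero lower left entry, as otherwise
    [th - iota th 0 0] would be a nonzero element with a singular matrix. *)
Lemma iota_iwasawa x : x \in unitmx ->
  exists b k, [/\ b \in unitmx, b 1 0 = 0, k != 0 & x = b *m iota k].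
Proof.
move=> hx.
have [th th10] : exists th, iota th 1 0 != 0.
  have : ~~ ({:K} <= <[1 : K]>)%VS.
    apply/negP => /dimvS; case: HK => _ _ ->.
    by rewrite dim_vline oner_neq0.
  case/subvPn => th _ hth; exists th; apply: contra hth => /eqP th10.
  suff -> : th = (iota th 0 0)%:A by apply/vlineP; exists (iota th 0 0).
  apply/eqP; rewrite -subr_eq0; apply/negPn/negP => /iota_det_neq0.
  by rewrite det2E rmorphB /= iota_alg !mxE subrr th10 subrr mulr0 mul0r subrr eqxx.
pose k := (x 1 0 / iota th 1 0) *: th
          + (x 1 1 - x 1 0 / iota th 1 0 * iota th 1 1)%:A.
have k10 : iota k 1 0 = x 1 0.
  by rewrite rmorphD /= linearZ /= iota_alg !mxE addr0 divfK.
have k11 : iota k 1 1 = x 1 1.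
  by rewrite rmorphD /= linearZ /= iota_alg !mxE mulr1n addrC subrK.
have k0 : k != 0.
  apply: contraTneq hx => k0; rewrite unitmxE unitfE det2E -k10 -k11 k0.
  by rewrite rmorph0 !mxE !mulr0 subrr eqxx.
exists (x *m invmx (iota k)), k; split=> //.
- by rewrite unitmx_mul hx unitmx_inv iota_unitmx.
- have d0 := iota_det_neq0 k0.
  have -> : invmx (iota k) = inv2 (iota k).
    by rewrite -[LHS]mulmx1 -(mul2V d0) mulmxA mulVmx ?iota_unitmx // mul1mx.
  by rewrite mul2E !mx2_entry k10 k11; field.
- by rewrite mulmxKV // iota_unitmx.
Qed.

Variables (C : numFieldType) (nu : F -> C) (r : nat).
Hypotheses (Hnu : mul_char nu) (Hr : conductor v nu r) (r_gt0 : (0 < r)%N).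
Variable chi : K -> C.
Hypotheses (Hchi : mul_char chi).
Hypothesis chi_nu : forall x : F, x != 0 -> chi x%:A = nu x.
Hypothesis Hfin : finite_mod vK 1.

Lemma chi_neq0 k : k != 0 -> chi k != 0.
Proof.
move=> k0; apply/negP => /eqP e.
have : chi (k / k) = 0 by rewrite Hchi.2 ?invr_eq0 // e mul0r.
by move/eqP; rewrite divff // Hchi.1 oner_eq0.
Qed.

Definition trivial_on_higher m : Prop :=
  forall u, u \in higher_unit vK m -> chi u = 1.

Lemma chi_Bgrp m u : (0 < m)%N -> trivial_on_higher m -> u \in unitO vK ->
  iota u \in Bgrp v m -> chi u = nu (iota u 0 0).
Proof.
move=> m0 Hm hu huB; have [a_unit _] := Bgrp_diag Hv m0 huB.
have /BgrpP[_ /(iota_lower_left hu)] := huB.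
set a := iota u 0 0 in a_unit *; move=> ha.
have aU := alg_unitO a_unit; have a0 := unitO_nz aU.
have {1}-> : u = a%:A * (u / a%:A) by rewrite mulrCA divff // mulr1.
rewrite Hchi.2 ?mulf_neq0 ?invr_eq0 ?(unitO_nz hu) // chi_nu ?(unitO_nz a_unit) //.
rewrite Hm ?mulr1 // inE (unitO_div HvK) //= -(powP_unitM HvK _ _ aU).
by rewrite mulrBr mulrCA divff // !mulr1.
Qed.

Definition twist (f : 'M[F]_2 -> C) : K -> C :=
  fun u => (chi u)^-1 * f (iota u).

(** The integral of [chi^-1 * f] over [K^* / F^*], which is the image of [O_K^*]
    because [K] is unramified. *)
Definition period (f : 'M[F]_2 -> C) : C := mean vK (twist f).

Lemma twist_smooth n m f : trivial_on_higher m ->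
    (forall u y, u \in unitO vK -> y \in higher_unit vK n ->
       f (iota u *m iota y) = f (iota u)) ->
  unit_smooth vK (maxn n m) (twist f).
Proof.
move=> Hm Hf u y hu hy.
have hyO := higher_unitO hy.
rewrite /twist Hchi.2 ?(unitO_nz hu) ?(unitO_nz hyO) // rmorphM /=.
rewrite (Hm y) ?mulr1 ?Hf //; apply: higher_unitW hy; first exact: leq_maxl.
exact: leq_maxr.
Qed.

Lemma section_smooth t psi u y : (r <= t)%N -> radial v t psi ->
    u \in unitO vK -> y \in higher_unit vK t ->
  section v nu r psi (iota u *m iota y) = section v nu r psi (iota u).
Proof.
move=> rt Hpsi hu hy; have [hB h00] := congruence_Bgrp (iota_higher_unit hy).
rewrite (section_mulr Hv Hnu Hr r_gt0 rt Hpsi (Hiota hu) hB).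
have [yU _] := Bgrp_diag Hv r_gt0 (BgrpW rt hB).
by rewrite (nu_congr Hv Hnu Hr r_gt0 yU (powPW rt h00)) Hnu.1 mul1r.
Qed.

(** The section is invariant under [1 + P^t O_K]; the translation by [h] thus
    multiplies the integrand by [(chi h)^-1] without changing the integral. *)
Lemma period_section_eq0 s t psi h : (r <= t)%N -> radial v t psi ->
    trivial_on_higher s -> h \in higher_unit vK t -> chi h != 1 ->
  period (section v nu r psi) = 0.
Proof.
move=> rt Hpsi Hs hh chih.
have Hsm : unit_smooth vK (maxn t s) (twist (section v nu r psi)).
  by apply: twist_smooth => // u y hu hy; apply: section_smooth rt Hpsi hu hy.
have hO := higher_unitO hh.
have := mean_translate HvK Hfin Hsm hO.
rewrite (mean_ext HvK Hfin (n := maxn t s)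
  (g := fun u => (chi h)^-1 * twist (section v nu r psi) u)).
- rewrite (mean_scale HvK Hfin _ Hsm) -/(period _) => /eqP.
  rewrite -subr_eq0 -{2}[period _]mul1r -mulrBl mulf_eq0 subr_eq0.
  by rewrite invr_eq1 (negbTE chih) => /eqP.
- by move=> u y hu hy; rewrite Hsm.
- move=> u hu; rewrite /twist Hchi.2 ?(unitO_nz hu) ?(unitO_nz hO) // invfM rmorphM /=.
  by rewrite (section_smooth rt Hpsi) // mulrA [(chi u)^-1 * _]mulrC.
Qed.

(** On the units of [K] that lie in [B(m)] the characters [chi] and [nu] cancel,
    so that the period is the volume of that set. *)
Lemma period_indicator_neq0 m : (r <= m)%N -> trivial_on_higher m ->
  period (section v nu r (fun c => (c \in powP v m)%:R)) != 0.
Proof.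
move=> rm Hm; have m_gt0 := leq_trans r_gt0 rm.
pose A := [pred u | (u \in unitO vK) && (iota u \in Bgrp v m)].
have Ag u y : u \in unitO vK -> y \in higher_unit vK m -> (u * y \in A) = (u \in A).
  move=> hu hy; have [hB _] := congruence_Bgrp (iota_higher_unit hy).
  rewrite ![_ \in A]inE hu (unitOM HvK) ?(higher_unitO hy) //= rmorphM.
  exact: (Bgrp_mulr Hv m_gt0 (Hiota hu) hB).
have HA : unit_smooth vK m (fun u => (u \in A)%:R : C).
  by move=> u y hu hy; rewrite Ag.
rewrite /period (mean_ext HvK Hfin HA); first apply: (mean_indicator_neq0 HvK Hfin HA).
  move=> u hu; rewrite inE (higher_unitO hu) /=.
  by have [] := congruence_Bgrp (iota_higher_unit hu).
move=> u hu; rewrite /twist /section [_ \in A]inE hu /= ![_ \in Bgrp v _]inE Hiota //=.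
have [hm|hm] := boolP (iota u 1 0 \in powP v m); last by rewrite mulr0 if_same mulr0.
have uB : iota u \in Bgrp v m by apply/BgrpP; split=> //; apply: Hiota.
have [/unitO_nz a0 _] := Bgrp_diag Hv m_gt0 uB.
rewrite (powPW rm hm) mulr1 (chi_Bgrp m_gt0 Hm hu uB) mulVf // -chi_nu //.
exact/chi_neq0/alg_neq0.
Qed.

End Torus.

(** * The principal series *)

Section PrincipalSeries.
Variables (R : realType) (F : fieldType) (v : F -> int).
Hypothesis Hv : normalized_valuation v.
Variable nu : F -> R[i].
Local Notation Pi := (principal_series v nu).

Lemma Pi_mull_O f b x : Pi f -> b \in GL2O v -> b 1 0 = 0 -> x \in unitmx ->
  f (b *m x) = nu (b 0 0) * f x.
Proof.
move=> [_ Hf _] hb b10 hx; rewrite Hf ?(GL2O_unitmx hb) //.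
have [h00 h11] : b 0 0 \in unitO v /\ b 1 1 \in unitO v.
  by apply: (Bgrp_diag Hv (m := 1)) => //; apply/BgrpP; rewrite b10 powP_0.
by rewrite /sqrt_abs (unitO_val (unitO_div Hv h00 h11)) oppr0 expr0z mulr1.
Qed.

Lemma Pi_scalar f (a : F) (x : 'M[F]_2) : Pi f -> a != 0 -> f (a *: x) = nu a * f x.
Proof.
move=> [f0 Hf _] a0; have [hx|hx] := boolP (x \in unitmx).
  have aU : a%:M \in @unitmx F 2 by rewrite unitmxE det_scalar unitfE expf_neq0.
  rewrite -mul_scalar_mx Hf // ?mxE ?mulr0n ?mulr1n //=.
  by rewrite /sqrt_abs divff // (valuation1 Hv) oppr0 expr0z mulr1.
rewrite !f0 ?mulr0 //; apply: contra hx; rewrite !unitmxE detZ !unitfE.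
by rewrite mulf_eq0 negb_or => /andP[].
Qed.

Lemma principal_congruenceW m n k : (m <= n)%N ->
  k \in principal_congruence v n -> k \in principal_congruence v m.
Proof.
move=> mn /andP[hk h]; rewrite inE hk /=.
apply/forallP => i; apply/forallP => j; apply: powPW mn _.
exact: (forallP (forallP h i) j).
Qed.

(** [GL_2(O)] normalizes the principal congruence subgroups, so it preserves
    smoothness. *)
Lemma Pi_rho_O f g : g \in GL2O v -> Pi f -> Pi (rho g f).
Proof.
move=> hg [f0 Hf [n Hn]]; have gU := GL2O_unitmx hg; rewrite /rho; split.
- by move=> x hx; apply: f0; rewrite unitmx_mul gU andbT.
- by move=> b x hb b10 hx; rewrite -mulmxA Hf // unitmx_mul hx.
exists n => k x /andP[hk /forallP hk1].
have d0 := unitO_nz (GL2O_det hg).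
have -> : x *m k *m g = x *m g *m (inv2 g *m k *m g).
  by rewrite -!mulmxA [in RHS](mulmxA g) mul2V // mul1mx.
apply: Hn; rewrite inE; have hgV := GL2OV Hv hg.
rewrite !(GL2OM Hv) //=; apply/forallP => i; apply/forallP => j.
have -> : (inv2 g *m k *m g) i j - (i == j)%:R = (inv2 g *m (k - 1%:M) *m g) i j.
  by rewrite mulmxBr mulmx1 mulmxBl inv2_mul // !mxE.
rewrite !mul2E; apply: (powPD Hv); apply: (powPMr Hv); rewrite ?GL2O_entry //;
  apply: (powPD Hv); apply: (powPMl Hv); rewrite ?GL2O_entry //;
  by have := forallP (hk1 _) _; rewrite !mxE; apply.
Qed.

Lemma Pi_subspace : linear_subspace Pi.
Proof.
split.
  by split=> [//|b x _ _ _|]; [rewrite mulr0|exists 0%N].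
move=> a f g [f0 Hf [n Hn]] [g0 Hg [m Hm]]; split.
- by move=> x hx; rewrite f0 // g0 // mulr0 addr0.
- by move=> b x hb b10 hx; rewrite Hf // Hg // mulrDr mulrCA.
exists (maxn n m) => k x hk.
rewrite Hn ?Hm //; apply: principal_congruenceW hk; first exact: leq_maxr.
exact: leq_maxl.
Qed.

End PrincipalSeries.

Section LinearForms.
Variables (T : Type) (C : fieldType) (V : set (T -> C)) (l : (T -> C) -> C).
Hypothesis HV : linear_subspace V.
Hypothesis Hl : forall a f g, V f -> V g ->
  l (fun x => a * f x + g x) = a * l f + l g.

Lemma linear_form0 : l (fun=> 0) = 0.
Proof.
transitivity (-1 * l (fun=> 0) + l (fun=> 0)); last by rewrite mulN1r addNr.
rewrite -(Hl _ HV.1 HV.1); congr l; apply/funext => x.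
by rewrite mulr0 addr0.
Qed.

Lemma linear_formZ a f : V f -> l (fun x => a * f x) = a * l f.
Proof.
move=> Vf; rewrite -[RHS]addr0 -linear_form0 -(Hl _ Vf HV.1).
by congr l; apply/funext => x; rewrite addr0.
Qed.

Lemma subspace_sum (I : Type) (s : seq I) (a : I -> C) (f : I -> T -> C) :
  (forall i, V (f i)) -> V (fun x => \sum_(i <- s) a i * f i x).
Proof.
move=> Vf; elim: s => [|i s IH].
  rewrite (_ : (fun x => _) = (fun=> 0)); first exact: HV.1.
  by apply/funext => x; rewrite big_nil.
rewrite (_ : (fun x => _) = (fun x => a i * f i x + \sum_(j <- s) a j * f j x)).
  exact: HV.2.
by apply/funext => x; rewrite big_cons.
Qed.

Lemma linear_form_sum (I : Type) (s : seq I) (a : I -> C) (f : I -> T -> C) :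
    (forall i, V (f i)) ->
  l (fun x => \sum_(i <- s) a i * f i x) = \sum_(i <- s) a i * l (f i).
Proof.
move=> Vf; elim: s => [|i s IH].
  rewrite big_nil -[RHS]linear_form0; congr l.
  by apply/funext => x; rewrite big_nil.
rewrite big_cons -IH -(Hl _ (Vf i) (subspace_sum s a Vf)); congr l.
by apply/funext => x; rewrite big_cons.
Qed.

End LinearForms.

(** * The invariant functional *)

Section Functional.
Variables (R : realType) (F : fieldType) (v : F -> int).
Hypothesis Hv : normalized_valuation v.
Variable nu : F -> R[i].
Local Notation Pi := (principal_series v nu).
Variables (K : fieldExtType F) (vK : K -> int).
Hypothesis HK : unramified_quadratic v vK.
Variable iota : {lrmorphism K -> 'M[F]_2}.
Hypothesis Hiota : forall u : K, u \in unitO vK -> iota u \in GL2O v.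
Variable chi : K -> R[i].
Hypotheses (Hchi : mul_char chi).
Hypothesis chi_nu : forall x : F, x != 0 -> chi x%:A = nu x.
Hypothesis Hfin : finite_mod vK 1.
Variable s : nat.
Hypothesis Hs : trivial_on_higher vK chi s.

Let HvK : normalized_valuation vK. Proof. by case: HK. Qed.

Lemma Pi_twist_smooth f : Pi f -> exists n, unit_smooth vK n (twist iota chi f).
Proof.
move=> [_ _ [n Hn]]; exists (maxn n s); apply: (twist_smooth Hchi Hs) => u y hu hy.
exact/Hn/(iota_higher_unit Hv HK Hiota).
Qed.

Lemma Pi_rho_torus k f : k != 0 -> Pi f -> exists a u,
  [/\ a != 0, u \in unitO vK, k = a *: u,
      rho (iota k) f = (fun x => nu a * rho (iota u) f x) & Pi (rho (iota u) f)].
Proof.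
move=> k0 Vf; have [a [u [a0 hu kE _]]] := scale_factor Hv HK k0.
exists a, u; split=> //; last by apply: Pi_rho_O => //; apply: Hiota.
apply/funext => x; rewrite /rho kE linearZ /= -scalemxAr.
exact: (Pi_scalar Hv _ Vf).
Qed.

Lemma chi_scale a u : a != 0 -> u \in unitO vK -> chi (a *: u) = nu a * chi u.
Proof.
move=> a0 hu; rewrite -mulr_algl Hchi.2 ?(unitO_nz hu) ?chi_nu //.
by rewrite scaler_eq0 negb_or a0 oner_neq0.
Qed.

Lemma period_HomK : HomK iota chi Pi (period vK iota chi).
Proof.
have Hlin a f g : Pi f -> Pi g ->
    period vK iota chi (fun x => a * f x + g x) =
      a * period vK iota chi f + period vK iota chi g.
  move=> /Pi_twist_smooth[n Hf] /Pi_twist_smooth[m Hg].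
  have Hf' := unit_smoothW (leq_maxl n m) Hf; have Hg' := unit_smoothW (leq_maxr n m) Hg.
  rewrite /period -(mean_linear HvK Hfin _ Hf' Hg'); congr mean.
  by apply/funext => u; rewrite /twist mulrDr mulrCA.
split=> // k f k0 Vf; have [a [u [a0 hu kE -> Vu]]] := Pi_rho_torus k0 Vf.
rewrite (linear_formZ (Pi_subspace v nu) Hlin) // kE chi_scale // -mulrA.
congr (_ * _); have [n Hf] := Pi_twist_smooth Vf.
rewrite /period -(mean_translate HvK Hfin Hf hu) -(mean_scale HvK Hfin (n := n)).
  congr mean; apply/funext => z; rewrite /twist /rho rmorphM /=.
  have [->|z0] := eqVneq z 0.
    case: Vf => f0 _ _.
    by rewrite mul0r rmorph0 mul0mx -[0 * _]/(0 *m _) mul0mx f0 ?mulr0 // unitmxE det0 unitr0.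
  rewrite Hchi.2 ?(unitO_nz hu) // invfM [RHS]mulrA [X in _ = X * _]mulrCA divff ?mulr1 //.
  exact/(chi_neq0 Hchi)/(unitO_nz hu).
by move=> z y hz hy /=; rewrite mulrAC (Hf (z * u)) ?(unitOM HvK).
Qed.

(** The [chi]-isotypic projection of [f], once the representatives [t] are fine
    enough for [f]. *)
Definition isotypic N (t : 'I_N -> K) (f : 'M[F]_2 -> R[i]) : 'M[F]_2 -> R[i] :=
  fun x => \sum_i (N%:R^-1 * (chi (t i))^-1) * rho (iota (t i)) f x.

(** By equivariance [l] takes the value [l f / N] on each term. *)
Lemma HomK_isotypic n N (t : 'I_N -> K) f l : unit_reps vK n t ->
  HomK iota chi Pi l -> Pi f -> l (isotypic t f) = l f.
Proof.
move=> Ht [Hlin Htor] Vf.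
have Vt i : Pi (rho (iota (t i)) f) by apply: Pi_rho_O => //; apply/Hiota/Ht.1.
rewrite /isotypic (linear_form_sum (Pi_subspace v nu) Hlin _ _ Vt).
rewrite (eq_bigr (fun=> N%:R^-1 * l f)) => [|i _].
  rewrite sumr_const card_ord -[LHS]mulr_natl mulVKf //.
  by rewrite pnatr_eq0 -lt0n (reps_gt0 HvK Ht).
have ti0 := unitO_nz (Ht.1 i).
by rewrite Htor // mulrA mulfVK // (chi_neq0 Hchi).
Qed.

Lemma isotypic_Pi n N (t : 'I_N -> K) f : unit_reps vK n t -> Pi f ->
  Pi (isotypic t f).
Proof.
move=> Ht Vf; have Vt i : Pi (rho (iota (t i)) f).
  by apply: Pi_rho_O => //; apply/Hiota/Ht.1.
exact: (subspace_sum (Pi_subspace v nu) _ _ Vt).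
Qed.

Lemma isotypic_torus n N (t : 'I_N -> K) f u : unit_reps vK n t -> Pi f ->
    unit_smooth vK n (twist iota chi f) -> u \in unitO vK ->
  isotypic t f (iota u) = chi u * period vK iota chi f.
Proof.
move=> Ht Vf Hf hu; rewrite /period (meanE HvK Ht Hf).
rewrite -(reps_mean_translate HvK Ht Hf hu) /reps_mean mulrCA !mulr_sumr.
apply: eq_bigr => i _; rewrite /twist /rho -mulrA; congr (_ * _).
rewrite Hchi.2 ?(unitO_nz hu) ?(unitO_nz (Ht.1 i)) // invfM [RHS]mulrA.
rewrite [X in _ = X * _]mulrCA divff ?mulr1.
  by rewrite [t i * u]mulrC rmorphM.
exact/(chi_neq0 Hchi)/(unitO_nz hu).
Qed.

(** Multiplicity one. Since [GL_2(F) = B K^*], a function in [Pi] is determined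
    by its restriction to [K^*]; hence the isotypic projections of [f] and [g]
    are proportional, with the periods as coefficients. *)
Lemma isotypic_proportional n N (t : 'I_N -> K) f g x : unit_reps vK n t ->
    Pi f -> Pi g -> unit_smooth vK n (twist iota chi f) ->
    unit_smooth vK n (twist iota chi g) ->
  period vK iota chi g * isotypic t f x = period vK iota chi f * isotypic t g x.
Proof.
move=> Ht Vf Vg Hf Hg.
have Vif := isotypic_Pi Ht Vf; have Vig := isotypic_Pi Ht Vg.
have [hx|hx] := boolP (x \in unitmx); last first.
  by case: Vif => -> // _ _; case: Vig => -> // _ _; rewrite !mulr0.
have [b [k [hb b10 k0 ->]]] := iota_iwasawa HK iota hx.
have [a [u [a0 hu -> _]]] := scale_factor Hv HK k0.
have kU : iota (a *: u) \in unitmx.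
  apply/iota_unitmx/negP; rewrite scaler_eq0 (negbTE a0) /=.
  by rewrite (negbTE (unitO_nz hu)).
case: (Vif) => _ -> // _; case: (Vig) => _ -> // _.
rewrite linearZ /= (Pi_scalar Hv _ Vif) // (Pi_scalar Hv _ Vig) // !(isotypic_torus Ht) //.
rewrite -!mulrA; ring.
Qed.

Lemma period_generator u : Pi u -> period vK iota chi u != 0 ->
  HomK_generator iota chi Pi (period vK iota chi).
Proof.
move=> Vu pu; split; [exact: period_HomK|by exists u|move=> l Hl].
exists (l u / period vK iota chi u) => f Vf.
have [n Hf] := Pi_twist_smooth Vf; have [m Hu] := Pi_twist_smooth Vu.
have {}Hf := unit_smoothW (leq_maxl n m) Hf.
have {}Hu := unit_smoothW (leq_maxr n m) Hu.
have [N [t Ht]] := unit_reps_exist HvK (maxn n m) Hfin.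
have Vif := isotypic_Pi Ht Vf; have Viu := isotypic_Pi Ht Vu.
have : period vK iota chi u * l f = period vK iota chi f * l u.
  rewrite -(HomK_isotypic Ht Hl Vf) -(HomK_isotypic Ht Hl Vu).
  rewrite -!(linear_formZ (Pi_subspace v nu) Hl.1) //; congr l; apply/funext => x.
  exact: (isotypic_proportional _ Ht).
by move=> e; apply: (mulfI pu); rewrite e mulrA mulrCA divff // mulr1 mulrC.
Qed.

Lemma period_test_vector u : Pi u -> period vK iota chi u != 0 ->
  test_vector iota chi Pi u.
Proof.
move=> Vu pu; split=> //; exists (period vK iota chi) => //.
exact: period_generator Vu pu.
Qed.

Lemma Pi_vanish f : Pi f -> (forall x, x \in GL2O v -> f x = 0) ->
  forall x, f x = 0.
Proof.
move=> Vf H0 x; have [hx|hx] := boolP (x \in unitmx); last by case: Vf => ->.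
have [b [k [hb b10 k0 ->]]] := iota_iwasawa HK iota hx.
have [a [u [a0 hu kE _]]] := scale_factor Hv HK k0.
have kU := iota_unitmx iota k0; case: (Vf) => _ -> // _.
by rewrite kE linearZ /= (Pi_scalar Hv _ Vf) // H0 ?mulr0 //; apply: Hiota.
Qed.

End Functional.

(** * Test vectors *)

Section RadialSplit.
Variables (F : fieldType) (v : F -> int) (Hv : normalized_valuation v).
Variables (C : fieldType) (psi : F -> C) (t : nat) (z : F).
Hypotheses (Hpsi : radial v t.+1 psi) (z0 : z != 0) (vz : v z = t).

(** As [v z = t], [psi] already has the value [psi z] at valuation [t]: only the
    values on [P^t.+1] change. *)
Definition coarsen (c : F) : C := if c \in powP v t then psi z else psi c.

(** Outside [P^t], adding an element of [P^t] amounts to multiplying by a unit. *)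
Lemma coarsen_radial : radial v t coarsen.
Proof.
move=> c e d hc he hd; rewrite /coarsen.
have -> : (e * c + d \in powP v t) = (c \in powP v t).
  rewrite -(powP_unitM Hv t c he); apply/idP/idP => h; last exact: powPD.
  by rewrite -(addrK d (e * c)); apply: powPB.
case: ifPn => // hcN.
have c0 : c != 0 by apply: contra hcN => /eqP ->; exact: powP_0.
have dcP : d / c \in powP v 1.
  have [->|d0] := eqVneq d 0; first by rewrite mul0r powP_0.
  move: hd hcN; rewrite !powP_nz ?mulf_neq0 ?invr_eq0 // (valuationM Hv) ?invr_eq0 //.
  rewrite (valuationV Hv) // -ltNge => h1 h2.
  by rewrite -gtz0_ge1 subr_gt0 (lt_le_trans h2).
have -> : e * c + d = (e + d / c) * c + 0 by rewrite mulrDl divfK // addr0.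
by apply: Hpsi => //; [exact: (unitOD Hv (n := 1))|exact: powP_0].
Qed.

Lemma radial_split c : c \in ringO v ->
  psi c = coarsen c + (psi 0 - psi z) * (c \in powP v t.+1)%:R.
Proof.
move=> hc; rewrite /coarsen; have [ht|ht] := boolP (c \in powP v t); last first.
  have /negbTE -> : c \notin powP v t.+1 by apply: contra ht; apply: powPW.
  by rewrite mulr0 addr0.
have [hs|hs] := boolP (c \in powP v t.+1).
  rewrite mulr1 addrC subrK -[c]add0r -[in LHS](mul1r 0).
  by apply: Hpsi; rewrite ?(powP_0 v 0) ?unitO1.
rewrite mulr0 addr0; have c0 : c != 0 by apply: contra hs => /eqP ->; exact: powP_0.
have -> : c = c / z * z + 0 by rewrite divfK // addr0.
apply: Hpsi; rewrite ?powP_0 //; first by rewrite powP_nz // vz.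
rewrite inE mulf_neq0 ?invr_eq0 //= (valuationM Hv) ?invr_eq0 // (valuationV Hv) // vz.
move: ht hs; rewrite !powP_nz // -ltNge -addn1 PoszD ltzD1 => h1 h2.
by rewrite subr_eq0 eq_le h1 h2.
Qed.

End RadialSplit.

(** Two steps, from [Qp] to [F] and from [F] to [K]. *)
Lemma finite_residue_padic (p : nat) (Qp : fieldType) (vp : Qp -> int)
    (F : fieldExtType Qp) (v : F -> int) (K : fieldExtType F) (vK : K -> int) :
    is_Qp p vp -> padic_field vp v -> unramified_quadratic v vK ->
  finite_mod vK 1.
Proof.
move=> HQp [Hv [e e0 Hext]] [HvK HextK _].
apply: (finite_residue_ext Hv HvK (ltn0Sn 0) HextK).
exact: (finite_residue_ext (Qp_val HQp) Hv e0 Hext (finite_residue_Qp HQp)).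
Qed.

Section Level.
Variables (F : fieldType) (v : F -> int) (Hv : normalized_valuation v).
Variables (K : fieldExtType F) (vK : K -> int) (HK : unramified_quadratic v vK).
Variables (C : numFieldType) (chi : K -> C) (s : nat) (Hs : level v vK chi s).

Lemma level_trivial : trivial_on_higher vK chi s.
Proof.
case: Hs => _ Htriv _ u /andP[hu /(powP_factor Hv HK)[a [y [ha hy e]]]].
by apply: (Htriv u a y) => //; rewrite -e addrC subrK.
Qed.

Lemma level_nontrivial t : (0 < t < s)%N ->
  exists2 h, h \in higher_unit vK t & chi h != 1.
Proof.
case: Hs => _ _ Hmin /andP[t0 ts]; apply: contrapT => Hno.
have HvK : normalized_valuation vK by case: HK.
suff : (s <= t)%N by rewrite leqNgt ts.
apply: Hmin => // u a y hu ha hy uE; apply/eqP/negPn/negP => chiu; apply: Hno; exists u => //.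
rewrite inE hu uE addrC addKr -mulr_algl; apply: (powPMr HvK) => //.
by rewrite (alg_powP HK).
Qed.

End Level.

Section Main.
Variables (R : realType) (F : fieldType) (v : F -> int).
Hypothesis Hv : normalized_valuation v.
Variables (nu : F -> R[i]) (r : nat).
Hypotheses (Hnu : mul_char nu) (Hr : conductor v nu r) (r_gt0 : (0 < r)%N).
Local Notation Pi := (principal_series v nu).
Variables (K : fieldExtType F) (vK : K -> int).
Hypothesis HK : unramified_quadratic v vK.
Variable iota : {lrmorphism K -> 'M[F]_2}.
Hypothesis Hiota : forall u : K, u \in unitO vK -> iota u \in GL2O v.
Variable chi : K -> R[i].
Hypotheses (Hchi : mul_char chi).
Hypothesis chi_nu : forall x : F, x != 0 -> chi x%:A = nu x.
Hypothesis Hfin : finite_mod vK 1.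
Local Notation indicator m := (fun c => (c \in powP v m)%:R : R[i]).

Let HvK : normalized_valuation vK. Proof. by case: HK. Qed.

Lemma indicator_radial m : radial v m (indicator m).
Proof.
move=> c e d hc he hd; congr ((_ : bool)%:R).
rewrite -(powP_unitM Hv m c he); apply/idP/idP => h; last exact: powPD.
by rewrite -(addrK d (e * c)); apply: powPB.
Qed.

(** The new vector is a multiple of the section of the indicator of [P^r], whose
    period is a volume. *)
Lemma new_vector_test s f : (s <= r)%N -> trivial_on_higher vK chi s ->
  Pi f -> nu_eigenvector v nu r f -> test_vector iota chi Pi f.
Proof.
move=> sr Hs Vf [[x0 fx0] feig].
have Hrt : trivial_on_higher vK chi r by move=> u /(higher_unitW sr)/Hs.
have f_mull b x : b \in GL2O v -> b 1 0 = 0 -> x \in GL2O v ->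
    f (b *m x) = nu (b 0 0) * f x.
  by move=> hb b10 /GL2O_unitmx hx; apply: (Pi_mull_O Hv).
have f_mulr k x : k \in Bgrp v r -> f (x *m k) = nu (k 0 0) * f x := feig k x.
have fE x : x \in GL2O v -> f x = f 1%:M * section v nu r (indicator r) x.
  move=> hx; rewrite (eigenvector_section Hv Hnu Hr r_gt0 f_mull f_mulr hx).
  rewrite /section; case: ifPn => [/BgrpP[_ x10]|_]; last by rewrite mulr0.
  rewrite x10 mulr1 mulrC; congr (_ * _).
  have := f_mulr (lower (x 1 0)) 1%:M (lower_Bgrp Hv x10).
  by rewrite mul1mx mx2_entry Hnu.1 mul1r.
have f1 : f 1%:M != 0.
  apply: contra_neq fx0 => f1; apply: (Pi_vanish Hv HK Hiota Vf) => x hx.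
  by rewrite fE // f1 mul0r.
apply: (period_test_vector Hv HK Hiota Hchi chi_nu Hfin Hs Vf).
have Hsm : unit_smooth vK r (twist iota chi (section v nu r (indicator r))).
  have := twist_smooth Hchi Hrt (iota := iota) (n := r); rewrite maxnn; apply=> u y hu hy.
  exact: (section_smooth Hv HK Hiota Hnu Hr r_gt0 (leqnn r) (@indicator_radial r)).
rewrite /period (mean_ext HvK Hfin (n := r)
  (g := fun u => f 1%:M * twist iota chi (section v nu r (indicator r)) u)).
- rewrite (mean_scale HvK Hfin _ Hsm) mulf_neq0 //.
  exact: (period_indicator_neq0 Hv HK Hiota).
- by move=> u y hu hy; rewrite Hsm.
- by move=> u hu; rewrite /twist (fE _ (Hiota hu)) mulrCA.
Qed.

(** On [GL_2(O)] the function [f] is [G + kappa * E], with [G] the section of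
    [coarsen psi] and [E] the section supported on [B(t.+1)]. The period of [G]
    is zero and that of [E] is not, while [kappa = 0] would place [f] both in
    the complement [W] and in [Ind_{B(t)} nu]. *)
Lemma complement_vector_test t W f : (r <= t)%N -> level v vK chi t.+1 ->
    uP v nu r t.+1 W -> uP_in_Pi v nu W f -> nu_eigenvector v nu t.+1 f ->
  test_vector iota chi Pi f.
Proof.
move=> rt Hlev [_ _ _ _ HW] [Vf Wf] [[x0 fx0] feig].
have Hs := level_trivial Hv HK Hlev.
have [h hh chih] : exists2 h, h \in higher_unit vK t & chi h != 1.
  by apply: (level_nontrivial HK Hlev); rewrite ltnS leqnn (leq_trans r_gt0 rt).
have rt1 : (r <= t.+1)%N by apply: leqW.
have f_mull b x : b \in GL2O v -> b 1 0 = 0 -> x \in GL2O v ->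
    f (b *m x) = nu (b 0 0) * f x.
  by move=> hb b10 /GL2O_unitmx hx; apply: (Pi_mull_O Hv).
have f_mulr k x : k \in Bgrp v t.+1 -> f (x *m k) = nu (k 0 0) * f x := feig k x.
pose psi c := f (lower c).
have fE x : x \in GL2O v -> f x = section v nu r psi x.
  exact: (eigenvector_section Hv Hnu Hr r_gt0 f_mull f_mulr).
have Hpsi : radial v t.+1 psi := eigenvector_radial Hv Hnu f_mull f_mulr.
have [w w0 vw] := uniformizer_exists Hv.
pose z := w ^+ t; have z0 : z != 0 by rewrite expf_neq0.
have vz : v z = t by rewrite (valuationX Hv) // vw natz.
pose G := section v nu r (coarsen v psi t z).
pose E := section v nu r (indicator t.+1).
have HG := coarsen_radial Hv z Hpsi.
have fGE x : x \in GL2O v -> f x = (psi 0 - psi z) * E x + G x.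
  move=> hx; rewrite fE // /E /G /section; case: ifP; last by rewrite mulr0 add0r.
  by rewrite (radial_split Hv Hpsi z0 vz) ?(GL2O_entry _ _ hx) // mulrDr mulrCA addrC.
have kappa : psi 0 - psi z != 0.
  apply: contra_neq fx0 => k0; apply: (Pi_vanish Hv HK Hiota Vf) => x hx.
  have GE y : restrO v f y = G y.
    rewrite /restrO; case: ifPn => hy; first by rewrite fGE // k0 mul0r add0r.
    by rewrite /G /section ifN //; apply: contra hy => /andP[].
  have := HW _ Wf; rewrite /restrO => /(_ _ x); rewrite hx; apply.
  exists (fun j => if j == t then G else fun=> 0); split=> [j _|y].
    case: eqP => [->|_]; last by split=> // *; rewrite mulr0.
    split=> [y hy|b y hb hy]; last exact: (section_mull Hv Hnu Hr r_gt0 rt HG).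
    by rewrite -GE /restrO (negbTE hy).
  rewrite -/(restrO v f y) GE big_nat_recr //= eqxx big_nat big1 ?add0r // => j.
  by case/andP=> _ jt; rewrite ltn_eqF.
apply: (period_test_vector Hv HK Hiota Hchi chi_nu Hfin Hs Vf).
have sm psi' : radial v t.+1 psi' -> unit_smooth vK t.+1 (twist iota chi (section v nu r psi')).
  move=> H'; have := twist_smooth Hchi Hs (iota := iota) (n := t.+1).
  rewrite maxnn; apply=> u y hu hy.
  exact: (section_smooth Hv HK Hiota Hnu Hr r_gt0 rt1 H').
have smE := sm _ (@indicator_radial t.+1).
have smG : unit_smooth vK t.+1 (twist iota chi G).
  by apply: sm => c e d hc he hd; apply: HG => //; apply: powPW hd.
rewrite /period (mean_ext HvK Hfin (n := t.+1)
  (g := fun u => (psi 0 - psi z) * twist iota chi E u + twist iota chi G u)).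
- rewrite (mean_linear HvK Hfin _ smE smG) -![mean _ (twist _ _ _)]/(period _ _ _ _).
  rewrite (period_section_eq0 Hv HK Hiota Hnu Hr r_gt0 Hchi Hfin rt HG Hs hh chih) addr0.
  by rewrite mulf_neq0 // (period_indicator_neq0 Hv HK Hiota).
- by move=> u y hu hy; rewrite smE ?smG.
- by move=> u hu; rewrite /twist (fGE _ (Hiota hu)) mulrDr mulrCA.
Qed.

End Main.

Theorem theorem2p5 (R : realType) (p : nat)
  (Qp : fieldType) (vp : Qp -> int) (HQp : is_Qp p vp)
  (F : fieldExtType Qp) (v : F -> int) (HF : padic_field vp v)
  (nu : F -> R[i]) (r : nat) (Hnu : mul_char nu)
  (Hr : conductor v nu r) (r_ge1 : (1 <= r)%N)
  (K : fieldExtType F) (vK : K -> int) (HK : unramified_quadratic v vK)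
  (iota : {lrmorphism K -> 'M[F]_2})
  (Hiota : forall u : K, u \in unitO vK -> iota u \in GL2O v)
  (chi : K -> R[i]) (s : nat) (Hchi : mul_char chi)
  (chi_nu : forall x : F, x != 0 -> chi x%:A = nu x)
  (Hs : level v vK chi s) :
  ((r < s)%N ->
     forall W : set ('M[F]_2 -> R[i]), uP v nu r s W ->
     forall u_s : 'M[F]_2 -> R[i],
       uP_in_Pi v nu W u_s -> nu_eigenvector v nu s u_s ->
       test_vector iota chi (principal_series v nu) u_s) /\
  ((s <= r)%N ->
     forall v_r : 'M[F]_2 -> R[i],
       principal_series v nu v_r -> nu_eigenvector v nu r v_r ->
       test_vector iota chi (principal_series v nu) v_r).
Proof.
have Hfin := finite_residue_padic HQp HF HK; have Hv := HF.1.
split=> [rs W HW u_s Hu Hun|sr v_r].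
  case: s Hs rs HW Hun => [//|t] Hs rs HW Hun.
  exact: (complement_vector_test Hv Hnu Hr r_ge1 HK Hiota Hchi chi_nu Hfin rs Hs HW).
exact: (new_vector_test Hv Hnu Hr r_ge1 HK Hiota Hchi chi_nu Hfin sr (level_trivial Hv HK Hs)).
Qed.
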